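(* Let $k\ge 3$ be an integer and let $F$ be a graph with chromatic number $\chi(F)=k+1$. For every $\varepsilon>0$ there exist $\sigma>0$ and $n_0$ such that every $F$-free graph $G$ on $n\ge n_0$ vertices with \[ q(G)\ge 2\left(1-\frac{1}{k}-\sigma\right)n \] can be obtained from $T_{n,k}$ by adding and deleting at most $\varepsilon n^2$ edges.
   Context: All graphs are finite and simple. A graph is $F$-free if it contains no subgraph isomorphic to $F$. $q(G)$ denotes the largest eigenvalue of the signless Laplacian $Q(G)=D(G)+A(G)$. $T_{n,k}$ is the complete $k$-partite graph on $n$ vertices with part sizes differing by at most one. ''$G$ can be obtained from $T_{n,k}$ by adding and deleting at most $\varepsilon n^2$ edges'' means that the vertex set of $G$ can be identified with that of $T_{n,k}$ so that the symmetric difference of the two edge sets has at most $\varepsilon n^2$ elements. *)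

(* Defs.v *)
From HB Require Import structures.
From mathcomp Require Import all_boot all_order all_algebra all_fingroup.
From mathcomp Require Import boolp classical_sets reals.
Set Implicit Arguments. Unset Strict Implicit. Unset Printing Implicit Defensive.
Import Order.TTheory GRing.Theory Num.Theory.

Definition simple_graph (n : nat) (G : rel 'I_n) : Prop :=
  symmetric G /\ irreflexive G.

Definition colorable (m : nat) (F : rel 'I_m) (c : nat) : Prop :=
  exists f : 'I_m -> 'I_c, forall x y, F x y -> f x != f y.

Definition chromatic_number_is (m : nat) (F : rel 'I_m) (c : nat) : Prop :=
  colorable F c /\ forall d, (d < c)%N -> ~ colorable F d.

Definition contains_subgraph (m n : nat) (F : rel 'I_m) (G : rel 'I_n) : Prop :=
  exists phi : 'I_m -> 'I_n, injective phi /\ forall x y, F x y -> G (phi x) (phi y).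

Definition F_free (m n : nat) (F : rel 'I_m) (G : rel 'I_n) : Prop :=
  ~ contains_subgraph F G.

Definition degree (n : nat) (G : rel 'I_n) (i : 'I_n) : nat := #|[set j | G i j]|.

Local Open Scope ring_scope.

Definition signless_laplacian (R : realType) (n : nat) (G : rel 'I_n) : 'M[R]_n :=
  \matrix_(i, j) ((if i == j then (degree G i)%:R else 0) + (G i j)%:R).

(* largest eigenvalue of Q(G) (the eigenvalue set is finite, so sup = max) *)
Definition q_index (R : realType) (n : nat) (G : rel 'I_n) : R :=
  sup [set a : R | eigenvalue (signless_laplacian R G) a].

(* Turán graph T_{n,k}: vertex i in part (i mod k); parts differ by at most one *)
Definition turan (n k : nat) : rel 'I_n := fun i j => (i %% k != j %% k)%N.
Arguments turan n k : clear implicits.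

Definition edit_distance_via (n : nat) (G H : rel 'I_n) (p : {perm 'I_n}) : nat :=
  #|[set e : 'I_n * 'I_n | (e.1 < e.2)%N && (G e.1 e.2 != H (p e.1) (p e.2))]|.

Definition close_to (R : realType) (n : nat) (G H : rel 'I_n) (eps : R) : Prop :=
  exists p : {perm 'I_n}, (edit_distance_via G H p)%:R <= eps * (n%:R) ^+ 2.

(* Main.v *)
(* Deleting vertices that lower q(S)/|S| too little ends at a vertex set S of G all of whose
   vertices are equally hard to delete.  If y is the unit top eigenvector on S and w = y^2,
   this says that (q I - L) w is nearly constant for the Laplacian L; since q > |S| (here
   k >= 3 enters) w is nearly uniform, and so q is close to twice the average degree of S.
   If many vertices were deleted, q(S)/|S| has grown beyond 2 (1 - 1/k) by a constant, and
   repeating the deletion with a finer tolerance contradicts the Erdos-Stone theorem.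
   Otherwise G has almost the Turan number of edges and the Erdos-Simonovits stability
   argument applies.  Both of the latter rest on the observation that many vertices attached
   to every part of a complete j-partite graph K_j(T) extend it to K_{j+1}(t). *)
Require Import Defs.
From HB Require Import structures.
From mathcomp Require Import boolp classical_sets reals.
From mathcomp Require Import all_boot all_order all_algebra all_fingroup.
From mathcomp Require Import zify ring lra.
Set Implicit Arguments. Unset Strict Implicit. Unset Printing Implicit Defensive.
Import Order.TTheory GRing.Theory Num.Theory.
Local Open Scope ring_scope.

(** A large index does not by itself give many edges: the star on n vertices has q = n. This is why
    q must exceed |S| by a constant factor and why a regularised S is sought first. Deletion is
    steered by a harmonic potential: removing a vertex is profitable when it raises q(S)/|S| by more
    than (c/2)/|S|. As q(S)/|S| never exceeds 2 and the harmonic series diverges, the optimum is not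
    reached at a small S, and losing a constant proportion of the vertices adds a constant to
    q(S)/|S|. The tolerance c also governs the error 12 c made in passing from q to edge density.
    The gain from many deletions is a small multiple of c, below that error; hence a second round,
    whose tolerance is chosen after this gain. *)

(** * Blow-ups of complete graphs and the Erdos-Stone theorem *)

Definition nbrs (n : nat) (G : rel 'I_n) (S : {set 'I_n}) (u : 'I_n) : {set 'I_n} :=
  [set v in S | G u v].

(** Ordered pairs, hence twice the number of edges: the Turan density reads (1 - 1/k) |S|^2. *)
Definition arcs (n : nat) (G : rel 'I_n) (S : {set 'I_n}) : nat :=
  (\sum_(u in S) #|nbrs G S u|)%N.

(** Disjointness of the parts is not demanded: it follows when [G] is irreflexive. Indexing by [nat]
    lets a part be added without changing the type. *)
Definition has_blowup (r t n : nat) (G : rel 'I_n) (S : {set 'I_n}) : Prop :=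
  exists A : nat -> {set 'I_n},
    (forall i, (i < r)%N -> A i \subset S /\ #|A i| = t) /\
    (forall i j a b, (i < r)%N -> (j < r)%N -> i != j ->
       a \in A i -> b \in A j -> G a b).

Lemma subset_of_card (T : finType) (A : {set T}) (t : nat) :
  (t <= #|A|)%N -> exists2 B : {set T}, B \subset A & #|B| = t.
Proof.
move=> tA; exists [set x in take t (enum A)].
  by apply/subsetP => x; rewrite inE => /mem_take; rewrite mem_enum.
rewrite cardsE; have /card_uniqP-> : uniq (take t (enum A)) by rewrite take_uniq ?enum_uniq.
by rewrite size_takel -?cardE.
Qed.

Lemma has_blowup_leq (r t n : nat) (G : rel 'I_n) (S : {set 'I_n}) (A : nat -> {set 'I_n}) :
  (forall i, (i < r)%N -> A i \subset S /\ (t <= #|A i|)%N) ->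
  (forall i j a b, (i < r)%N -> (j < r)%N -> i != j ->
     a \in A i -> b \in A j -> G a b) ->
  has_blowup r t G S.
Proof.
move=> HA HG.
have /choice[B HB] (i : nat) : exists B : {set 'I_n},
    (i < r)%N -> B \subset A i /\ #|B| = t.
  case: (ltnP i r) => [/HA[_ /subset_of_card[B sB cB]]|_]; first by exists B.
  by exists set0.
exists B; split=> [i ir|i j a b ir jr ij aB bB].
  have [sB cB] := HB i ir; split => //; apply: (subset_trans sB).
  by case: (HA i ir).
have [sBi _] := HB i ir; have [sBj _] := HB j jr.
by apply: (HG i j) => //; [apply: (subsetP sBi)|apply: (subsetP sBj)].
Qed.

Lemma has_blowupS (r t n : nat) (G : rel 'I_n) (S S' : {set 'I_n}) :
  S \subset S' -> has_blowup r t G S -> has_blowup r t G S'.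
Proof.
move=> sS [A [HA HG]]; exists A; split=> // i /HA[sA cA]; split=> //.
exact: subset_trans sS.
Qed.

Lemma pigeonhole_fiber (T : finType) (V : finType) (g : T -> V) (W : {set T})
    (P : {set V}) (t : nat) :
  (forall w, w \in W -> g w \in P) -> (0 < t)%N -> (t * #|P| <= #|W|)%N ->
  (0 < #|W|)%N ->
  exists2 v, v \in P & (t <= #|[set w in W | g w == v]|)%N.
Proof.
move=> gP t0 cW W0; apply: contrapT => H.
have lt v : v \in P -> (#|[set w in W | g w == v]| < t)%N.
  by move=> vP; rewrite ltnNge; apply/negP => h; apply: H; exists v.
have E : #|W| = (\sum_(v in P) #|[set w in W | g w == v]|)%N.
  rewrite -sum1_card (partition_big g (mem P)) //=.
  by apply: eq_bigr => v vP; rewrite -sum1dep_card.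
have [v0 v0P] : exists v0, v0 \in P.
  by case/card_gt0P: W0 => w wW; exists (g w); apply: gP.
have : (#|W| < t * #|P|)%N; last by rewrite ltnNge cW.
rewrite E mulnC -sum_nat_const (bigD1 v0) //= [in ltnRHS](bigD1 v0) //=.
rewrite -addSn; apply: leq_add; first exact: lt.
by apply: leq_sum => v /andP[vP _]; apply: ltnW; apply: lt.
Qed.

(** A vertex of [W] leaves one of at most 2^(T j) traces on the j parts. By pigeonhole t vertices
    share a trace; they form the new part, and the old parts shrink to the common trace. *)
Lemma has_blowup_extend (j t T n : nat) (G : rel 'I_n) (S W : {set 'I_n})
    (A : nat -> {set 'I_n}) :
  symmetric G ->
  (forall i, (i < j)%N -> A i \subset S /\ #|A i| = T) ->
  (forall i i' a b, (i < j)%N -> (i' < j)%N -> i != i' ->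
     a \in A i -> b \in A i' -> G a b) ->
  W \subset S -> (forall w i, w \in W -> (i < j)%N -> (t <= #|nbrs G (A i) w|)%N) ->
  (t * 2 ^ (T * j) <= #|W|)%N -> has_blowup j.+1 t G S.
Proof.
move=> symG HA HG WS HW cW.
have [->|t0] := posnP t.
  exists (fun=> set0); split => [i _|i i' a b _ _ _]; last by rewrite inE.
  by rewrite sub0set cards0.
pose g w : {ffun 'I_j -> {set 'I_n}} := [ffun i : 'I_j => nbrs G (A i) w].
pose P := [set f in family (fun i : 'I_j => mem (powerset (A i)))].
have cP : #|P| = (2 ^ (T * j))%N.
  rewrite cardsE card_family -[X in _ = (2 ^ (T * X))%N]card_ord expnM.
  rewrite foldrE big_image /= -prod_nat_const.
  by apply: eq_bigr => i _ /=; rewrite card_powerset (HA i _).2.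
have W0 : (0 < #|W|)%N.
  by apply: leq_trans cW; rewrite muln_gt0 t0 expn_gt0.
have gP w : w \in W -> g w \in P.
  move=> wW; rewrite inE; apply/familyP => i; rewrite ffunE inE.
  by apply/subsetP => x; rewrite inE => /andP[].
have [|v vP tv] := pigeonhole_fiber gP t0 _ W0; first by rewrite cP.
set X := [set w in W | g w == v] in tv.
have gX w i (ij : (i < j)%N) : w \in X -> nbrs G (A i) w = v (Ordinal ij).
  by rewrite inE => /andP[_ /eqP<-]; rewrite ffunE.
have [w0 w0X] : exists w0, w0 \in X by apply/card_gt0P; apply: leq_trans tv.
pose B i := if i == j then X else nbrs G (A i) w0.
have adjX w b i (ij : (i < j)%N) : w \in X -> b \in nbrs G (A i) w0 -> G w b.
  by move=> wX; rewrite (gX _ _ ij w0X) -(gX _ _ ij wX) inE => /andP[].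
have w0W : w0 \in W by move: w0X; rewrite inE => /andP[].
apply: (@has_blowup_leq _ _ _ _ _ B) => [i|i i' a b].
  rewrite ltnS leq_eqVlt /B; case: eqP => /= [_ _|_ ij]; split => //.
  - by apply/subsetP => w; rewrite inE => /andP[/(subsetP WS)].
  - apply/subsetP => w; rewrite inE => /andP[wA _].
    by have [sA _] := HA i ij; apply: (subsetP sA).
  - exact: HW.
rewrite !ltnS (leq_eqVlt i) (leq_eqVlt i') /B.
case: (eqVneq i j) => [->|ij] /=; case: (eqVneq i' j) => [->|i'j] //=.
- by move=> _ lt _ aX bA; apply: (adjX _ _ _ lt).
- by move=> lt _ _ aA bX; rewrite symG; apply: (adjX _ _ _ lt).
move=> lt lt' ne aA bA; apply: (HG i i') => //.
  by move: aA; rewrite inE => /andP[].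
by move: bA; rewrite inE => /andP[].
Qed.

(** For irreflexive [G] a vertex of [S] is its own non-neighbour, so that neighbours and
    non-neighbours partition [S]. *)
Definition nonnbrs (n : nat) (G : rel 'I_n) (S : {set 'I_n}) (u : 'I_n) : {set 'I_n} :=
  [set v in S | ~~ G u v].

Lemma card_nbrsD (n : nat) (G : rel 'I_n) (S : {set 'I_n}) (u : 'I_n) :
  (#|nbrs G S u| + #|nonnbrs G S u|)%N = #|S|.
Proof.
rewrite -cardsUI (_ : nbrs G S u :&: nonnbrs G S u = set0) ?cards0 ?addn0.
  by apply: eq_card => v; rewrite !inE -andb_orr orbN andbT.
by apply/setP => v; rewrite !inE; case: (G u v); rewrite ?andbF ?andbT.
Qed.

Lemma nonnbrs_double_count (n : nat) (G : rel 'I_n) (A S : {set 'I_n}) :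
  symmetric G ->
  (\sum_(s in S) #|nonnbrs G A s| = \sum_(a in A) #|nonnbrs G S a|)%N.
Proof.
move=> symG.
transitivity (\sum_(s in S) \sum_(a in A) (~~ G s a : nat))%N.
  by apply: eq_bigr => s _; rewrite -big_mkcondr -sum1dep_card.
rewrite exchange_big /=; apply: eq_bigr => a _.
rewrite -sum1dep_card big_mkcondr /=.
by apply: eq_bigr => s _; rewrite symG; case: (G a s).
Qed.

Lemma natr_ge_exists (R : realType) (x : R) : exists n : nat, x <= n%:R.
Proof.
exists (Num.bound `|x|); apply: ltW; apply: le_lt_trans (ler_norm _) _.
exact: archi_boundP.
Qed.

Lemma sum_nonnbrs_le (R : realType) (b : R) (n : nat) (G : rel 'I_n) (A S : {set 'I_n}) :
  symmetric G -> A \subset S ->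
  (forall u, u \in S -> (1 - b) * #|S|%:R <= #|nbrs G S u|%:R) ->
  \sum_(s in S) #|nonnbrs G A s|%:R <= #|A|%:R * (b * #|S|%:R).
Proof.
move=> symG AS deg; rewrite -natr_sum nonnbrs_double_count // natr_sum.
rewrite mulr_natl -sumr_const; apply: ler_sum => a aA.
have := deg a (subsetP AS _ aA).
by rewrite -(card_nbrsD G S a) natrD; lra.
Qed.

(** Double counting of non-edges: a poorly attached vertex misses at least T - t vertices of some
    part, while each of the j T part vertices misses at most b |S| vertices of [S]. *)
Lemma card_poorly_attached (R : realType) (b : R) (j t T n : nat) (G : rel 'I_n)
    (S : {set 'I_n}) (A : nat -> {set 'I_n}) :
  symmetric G ->
  (forall i, (i < j)%N -> A i \subset S /\ #|A i| = T) ->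
  (forall u, u \in S -> (1 - b) * #|S|%:R <= #|nbrs G S u|%:R) -> (t <= T)%N ->
  #|[set s in S | [exists i : 'I_j, (#|nbrs G (A i) s| < t)%N]]|%:R * (T - t)%:R
    <= j%:R * (T%:R * (b * #|S|%:R)).
Proof.
move=> symG HA deg tT; set P := [set s in S | _].
apply: (@le_trans _ _ (\sum_(s in S) \sum_(i < j) #|nonnbrs G (A i) s|%:R)); last first.
  rewrite exchange_big /=.
  apply: (@le_trans _ _ (\sum_(i < j) T%:R * (b * #|S|%:R))).
    apply: ler_sum => i _; have [sA cA] := HA i (ltn_ord i).
    by rewrite -[in leRHS]cA; apply: sum_nonnbrs_le.
  by rewrite sumr_const card_ord -[leLHS]mulr_natl.
rewrite (big_setID P) /= -[leLHS]addr0; apply: lerD; last first.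
  by apply: sumr_ge0 => s _; apply: sumr_ge0 => i _.
rewrite (_ : S :&: P = P); last by apply/setP => s; rewrite !inE andbA andbb.
rewrite mulr_natl -sumr_const; apply: ler_sum => s; rewrite inE => /andP[sS /existsP[i lt]].
rewrite (bigD1 i) //= -[leLHS]addr0; apply: lerD; last by apply: sumr_ge0.
rewrite ler_nat; have := card_nbrsD G (A i) s.
have [_ ->] := HA i (ltn_ord i); move: lt. move: #|nbrs _ _ _| #|nonnbrs _ _ _| => x y. lia.
Qed.

Lemma has_blowup_min_degree (R : realType) (r : nat) (b : R) :
  0 <= b -> r.-1%:R * b < 1 -> forall t, exists N0 : nat, forall n (G : rel 'I_n) (S : {set 'I_n}),
    symmetric G -> (N0 <= #|S|)%N ->
    (forall u, u \in S -> (1 - b) * #|S|%:R <= #|nbrs G S u|%:R) ->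
    has_blowup r t G S.
Proof.
move=> b0; elim: r => [_ t|j IH /= jb t].
  by exists 0%N => n G S _ _ _; exists (fun=> set0); split.
have IHj : j.-1%:R * b < 1.
  by apply: le_lt_trans jb; rewrite ler_wpM2r // ler_nat leq_pred.
set jb' := j%:R * b in jb.
(* This gives t <= T (1 - jb) / 3, so the poorly attached vertices fill at most the fraction 3 jb /
   (2 + jb) < 1 of [S], and [N2] makes the rest numerous enough to extend the blow-up. *)
have [T1 HT1] := natr_ge_exists (3 * t%:R / (1 - jb')).
pose T := (T1 + t).+1.
have jb0 : 0 <= jb' by rewrite mulr_ge0.
have [N1 HN1] := IH IHj T.
have [N2 HN2] := natr_ge_exists (3 * (t * 2 ^ (T * j))%:R / (1 - jb')).
have jb1 : 0 < 1 - jb' by lra.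
exists (N1 + N2)%N => n G S symG leS deg.
have [A [HA HG]] := HN1 n G S symG (leq_trans (leq_addr _ _) leS) deg.
have tT : (t <= T)%N by rewrite /T; lia.
have := card_poorly_attached symG HA deg tT; set P := [set s in S | _] => cP.
apply: (@has_blowup_extend j t T n G S (S :\: P) A) => //.
- exact: subsetDl.
- move=> w i; rewrite !inE => /andP[+ wS] ij; rewrite wS /=.
  rewrite negb_exists => /forallP/(_ (Ordinal ij)) /=.
  by rewrite -leqNgt.
have sP : P \subset S by apply/subsetP => s; rewrite inE => /andP[].
rewrite -(ler_nat R) cardsDS // natrB ?subset_leq_card //.
have HT : 3 * t%:R <= T%:R * (1 - jb').
  rewrite -ler_pdivrMr // (le_trans HT1) // ler_nat /T; lia.
have HN : 3 * (t * 2 ^ (T * j))%:R <= #|S|%:R * (1 - jb').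
  by rewrite -ler_pdivrMr // (le_trans HN2) // ler_nat (leq_trans _ leS) ?leq_addl.
move: cP; rewrite natrB // mulrCA (mulrA j%:R) -/jb'.
have C0 : 0 <= (t * 2 ^ (T * j))%:R :> R by [].
move: (t * 2 ^ _)%:R HN C0 => C HN C0.
have T0 : 0 < T%:R :> R by rewrite ltr0n.
have t0 : 0 <= t%:R :> R by rewrite ler0n.
have S0 : 0 <= #|S|%:R :> R by rewrite ler0n.
have P0 : 0 <= #|P|%:R :> R by rewrite ler0n.
move: T%:R t%:R #|S|%:R #|P|%:R HT HN T0 t0 S0 P0 => {HT1 HN2 HG deg} x y N p HT HN x0 y0 N0 p0.
move: jb' jb jb0 jb1 HT HN => {IHj} c jb jb0 jb1 HT HN H.
have : p * (x - x * (1 - c) / 3) <= x * (c * N).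
  apply: le_trans H; rewrite ler_wpM2l //; lra.
have -> : p * (x - x * (1 - c) / 3) = x * (p * (2 + c) / 3) by field.
rewrite ler_pM2l // => H2.
have C3 : C * (2 + c) <= 3 * C by nra.
have : (N - p) * (2 + c) >= C * (2 + c) by lra.
by rewrite ler_pM2r //; lra.
Qed.

Lemma arcs_le_sqr (n : nat) (G : rel 'I_n) (S : {set 'I_n}) :
  (arcs G S <= #|S| ^ 2)%N.
Proof.
rewrite expnS expn1 -sum_nat_const; apply: leq_sum => u _.
by rewrite subset_leq_card //; apply/subsetP => v; rewrite inE => /andP[].
Qed.

Lemma arcsE (n : nat) (G : rel 'I_n) (S : {set 'I_n}) :
  arcs G S = (\sum_(u in S) \sum_(v in S) (G u v : nat))%N.
Proof. by apply: eq_bigr => u _; rewrite -big_mkcondr -sum1dep_card. Qed.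

Lemma card_nbrs_sum (n : nat) (G : rel 'I_n) (S : {set 'I_n}) (u : 'I_n) :
  #|nbrs G S u| = (\sum_(v in S) (G u v : nat))%N.
Proof. by rewrite -big_mkcondr -sum1dep_card. Qed.

Lemma arcsD1 (n : nat) (G : rel 'I_n) (S : {set 'I_n}) (u : 'I_n) :
  symmetric G -> irreflexive G -> u \in S ->
  arcs G S = (arcs G (S :\ u) + 2 * #|nbrs G S u|)%N.
Proof.
move=> symG irrG uS; rewrite !arcsE (big_setD1 u) //= -card_nbrs_sum.
have -> : (\sum_(i in S :\ u) \sum_(v in S) G i v =
   \sum_(i in S :\ u) G i u + \sum_(i in S :\ u) \sum_(v in S :\ u) G i v)%N.
  by rewrite -big_split; apply: eq_bigr => i _; rewrite (big_setD1 u).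
have -> : (\sum_(i in S :\ u) G i u = #|nbrs G S u|)%N.
  rewrite card_nbrs_sum [RHS](big_setD1 u) //= irrG add0n.
  by apply: eq_bigr => i _; rewrite symG.
by rewrite addnA addnn -mul2n addnC.
Qed.

(** Maximise arcs(X) - a |X|^2 over subsets: deleting u loses 2 deg(u) arcs and recovers a (2 |X| -
    1), so optimality is exactly the degree bound. The inequality on values prevents S' from being
    too small. *)
Lemma exists_min_degree_subset (R : realType) (a : R) (n : nat) (G : rel 'I_n)
    (S : {set 'I_n}) :
  symmetric G -> irreflexive G ->
  exists S' : {set 'I_n}, [/\ S' \subset S,
    (arcs G S)%:R - a * #|S|%:R ^+ 2 <= (arcs G S')%:R - a * #|S'|%:R ^+ 2 &
    forall u, u \in S' -> a * (#|S'|%:R - 1 / 2) <= #|nbrs G S' u|%:R].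
Proof.
move=> symG irrG.
pose f (X : {set 'I_n}) : R := (arcs G X)%:R - a * #|X|%:R ^+ 2.
case: (arg_maxP (P := [pred X : {set 'I_n} | X \subset S]) f (subxx S)) => S' /= sS max.
exists S'; split=> // [|u uS]; first exact: max.
have /max : S' :\ u \subset S by apply: subset_trans sS; apply: subsetDl.
rewrite /f (arcsD1 symG irrG uS) (cardsD1 u S') uS !natrD /=; lra.
Qed.

Lemma one_minus_inv_bounds (R : realType) (k : nat) : (0 < k)%N ->
  0 <= 1 - 1 / k%:R :> R /\ k%:R * (1 / k%:R) = 1 :> R /\ 0 < 1 / k%:R :> R.
Proof.
move=> k0; have k1 : 1 <= k%:R :> R by rewrite ler1n.
have k1' : 0 < k%:R :> R by apply: lt_le_trans k1.
split; first by rewrite subr_ge0 ler_pdivrMr // mul1r.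
by split; [rewrite mul1r divff // gt_eqF|rewrite divr_gt0].
Qed.

Lemma erdos_stone (R : realType) (k : nat) (c : R) : (0 < k)%N -> 0 < c ->
  forall t, exists N0 : nat, forall n (G : rel 'I_n) (S : {set 'I_n}),
    symmetric G -> irreflexive G -> (N0 <= #|S|)%N ->
    (1 - 1 / k%:R + c) * #|S|%:R ^+ 2 <= (arcs G S)%:R ->
    has_blowup k.+1 t G S.
Proof.
move=> k0 c0 t; have [th0 [kinv kpos]] := one_minus_inv_bounds R k0.
(* Ensures that [b] below is nonnegative. *)
wlog ck : c c0 / c <= 1 / k%:R.
  move=> H; pose c' := Num.min c (1 / k%:R).
  have [||N0 HN0] := H c'; first by rewrite lt_min c0.
    by rewrite ge_min lexx orbT.
  exists N0 => n G S symG irrG leS le; apply: HN0 => //.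
  apply: le_trans le; rewrite ler_wpM2r ?sqr_ge0 // lerD2l.
  by rewrite ge_min lexx.
have kR : 0 < k%:R :> R by rewrite ltr0n.
(* Of the excess c, half is given up to keep S' large and a quarter absorbs the -1/2 in the degree
   bound; the last quarter makes k b < 1. *)
set b := 1 / k%:R - c / 4.
have [||N1 HN1] := @has_blowup_min_degree R k.+1 b _ _ t.
- by rewrite /b; lra.
- by rewrite /b /= mulrBr kinv; nra.
have [M1 HM1] := natr_ge_exists (2 / c).
have [M HM] := natr_ge_exists (2 / c + 1).
exists ((N1 + M1).+1 * M)%N => n G S symG irrG leS le.
have [S' [sS le' deg]] := exists_min_degree_subset (1 - 1 / k%:R + c / 2) S symG irrG.
have le1 : (c / 2) * #|S|%:R ^+ 2 <= #|S'|%:R ^+ 2 :> R.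
  have := arcs_le_sqr G S'; rewrite -(ler_nat R) natrX.
  have := sqr_ge0 (#|S'|%:R : R); nra.
have big : ((N1 + M1).+1 <= #|S'|)%N.
  rewrite leqNgt; apply/negP => lt.
  move: leS; rewrite -(ler_nat R) natrM => leS.
  move: lt; rewrite -(ltr_nat R) => lt.
  have x0 : 0 <= #|S'|%:R :> R by [].
  have cc : 0 < 2 / c by rewrite divr_gt0.
  have ccE : (2 / c) * c = 2 by rewrite divfK // gt_eqF.
  move: (2 / c) HM cc ccE => d HM cc ccE.
  move: #|S'|%:R #|S|%:R (N1 + M1).+1%:R M%:R x0 lt leS le1 HM {le le' deg HM1}.
  move=> x s N m x0 lt leS le1 HM.
  have m0 : 0 < m by lra.
  have : (d + 1) * N <= s by apply: le_trans leS; rewrite mulrC ler_wpM2l; lra.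
  move=> ds; have : ((d + 1) * N) ^+ 2 <= s ^+ 2.
    by rewrite ler_pXn2r // nnegrE; nra.
  have : x ^+ 2 < N ^+ 2 by rewrite ltr_pXn2r // nnegrE; lra.
  rewrite exprMn => h1 h2.
  have : c / 2 * ((d + 1) ^+ 2 * N ^+ 2) < N ^+ 2.
    by apply: le_lt_trans h1; apply: le_trans le1; rewrite ler_wpM2l //; lra.
  have -> : c / 2 * ((d + 1) ^+ 2 * N ^+ 2) = (d * c / 2 * (d + 2) + c / 2) * N ^+ 2 by field.
  by rewrite ccE; have := sqr_ge0 N; nra.
apply: (has_blowupS sS); apply: HN1 => //; first by apply: leq_trans big; rewrite leqW ?leq_addr.
move=> u /deg; apply: le_trans.
have : M1%:R <= #|S'|%:R :> R by rewrite ler_nat (leq_trans _ big) // leqW ?leq_addl.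
move=> /(le_trans HM1); rewrite ler_pdivrMr // /b; lra.
Qed.

(** Vertex number x of [F] goes to element number x of the part of its colour, so parts of size m
    suffice. Images of different colours are adjacent, hence distinct by irreflexivity. *)
Lemma blowup_contains (k m n : nat) (F : rel 'I_m) (G : rel 'I_n) (S : {set 'I_n}) :
  irreflexive G -> colorable F k -> has_blowup k m G S -> contains_subgraph F G.
Proof.
move=> irrG [f Hf] [A [HA HG]].
have inA (x : 'I_m) : (x < #|A (f x)|)%N by have [_ ->] := HA _ (ltn_ord (f x)).
pose phi x := enum_val (Ordinal (inA x)).
have phiA x : phi x \in A (f x) by apply: enum_valP.
have adj x y : f x != f y -> G (phi x) (phi y).
  by move=> ne; apply: (HG (f x) (f y)).
exists phi; split=> [x y|x y /Hf]; last exact: adj.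
case: (eqVneq (f x) (f y)) => [e|/adj + e]; last by rewrite e irrG.
have nthE d z : phi z = nth d (enum (A (f z))) z by apply: enum_val_nth.
have [d _] : exists d : 'I_n, true by exists (phi x).
rewrite (nthE d x) (nthE d y).
rewrite e => /eqP; rewrite nth_uniq ?enum_uniq -?cardE //; first by move/eqP/val_inj.
by rewrite -e.
Qed.

(** * Stability *)

Definition color_class (n k : nat) (X : {set 'I_n}) (c : 'I_n -> 'I_k) (i : 'I_k) :
    {set 'I_n} :=
  [set s in X | c s == i].

Definition misplaced_pairs (n k : nat) (G : rel 'I_n) (X : {set 'I_n})
    (c : 'I_n -> 'I_k) : {set 'I_n * 'I_n} :=
  [set e | [&& e.1 \in X, e.2 \in X & G e.1 e.2 != (c e.1 != c e.2)]].

Lemma sum_card_color_class (n k : nat) (X : {set 'I_n}) (c : 'I_n -> 'I_k) :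
  (\sum_(i < k) #|color_class X c i| = #|X|)%N.
Proof.
rewrite -[RHS]sum1_card (partition_big c xpredT) //=.
by apply: eq_bigr => i _; rewrite -sum1dep_card.
Qed.

(** Holds pair by pair. Misplaced pairs are thereby few once non-edges are few in total, the classes
    nearly balanced and the arcs inside them rare; missing edges between classes need no separate
    count. *)
Lemma card_misplaced_pairs (n k : nat) (G : rel 'I_n) (X : {set 'I_n})
    (c : 'I_n -> 'I_k) :
  (#|misplaced_pairs G X c| + \sum_(i < k) #|color_class X c i| ^ 2 =
   \sum_(x in X) #|nonnbrs G X x| + 2 * \sum_(i < k) arcs G (color_class X c i))%N.
Proof.
have byclass (F : 'I_n -> 'I_n -> nat) :
    (\sum_(i < k) \sum_(x in color_class X c i) \sum_(y in color_class X c i) F x y =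
     \sum_(x in X) \sum_(y in X) (c x == c y) * F x y)%N.
  rewrite [RHS](partition_big c xpredT) //=; apply: eq_bigr => i _.
  apply: eq_big => [x|x]; rewrite inE // => /andP[_ /eqP cx].
  rewrite [RHS](bigID (fun y => c y == i)) /= [X in (_ + X)%N]big1 ?addn0.
    by apply: eq_big => [y|y]; rewrite inE // => /andP[_ /eqP ->]; rewrite cx eqxx mul1n.
  by move=> y /andP[_ /negbTE cy]; rewrite cx eq_sym cy.
have -> : (\sum_(i < k) #|color_class X c i| ^ 2 =
    \sum_(x in X) \sum_(y in X) (c x == c y) * 1)%N.
  by rewrite -byclass; apply: eq_bigr => i _; rewrite sum_nat_const sum1_card mulnn.
have -> : (\sum_(i < k) arcs G (color_class X c i) =
    \sum_(x in X) \sum_(y in X) (c x == c y) * G x y)%N.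
  by rewrite -byclass; apply: eq_bigr => i _; rewrite arcsE.
have -> : #|misplaced_pairs G X c| =
    (\sum_(x in X) \sum_(y in X) (G x y != (c x != c y)))%N.
  rewrite pair_big /= -big_mkcondr -sum1dep_card /=.
  by apply: eq_bigl => e; rewrite -andbA.
have -> : (\sum_(x in X) #|nonnbrs G X x| = \sum_(x in X) \sum_(y in X) (~~ G x y))%N.
  by apply: eq_bigr => x _; rewrite -big_mkcondr -sum1dep_card.
rewrite big_distrr -!big_split; apply: eq_bigr => x _ /=.
rewrite big_distrr -!big_split; apply: eq_bigr => y _ /=.
by case: (G x y); case: (c x == c y).
Qed.

(** The vertices of class i miss nearly all of [A i]. When the class has about the average size,
    they use up almost all non-edges that the degree condition allows at [A i], and the other
    vertices see nearly all of it. *)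
Lemma color_class_double_count (R : realType) (b : R) (k m T n : nat) (G : rel 'I_n)
    (S X : {set 'I_n}) (A : nat -> {set 'I_n}) (c : 'I_n -> 'I_k) (i : 'I_k) :
  symmetric G -> A i \subset S -> #|A i| = T -> X \subset S ->
  (forall u, u \in S -> (1 - b) * #|S|%:R <= #|nbrs G S u|%:R) ->
  (forall s, s \in X -> (#|nbrs G (A (c s)) s| < m)%N) ->
  (T%:R - m%:R) * #|color_class X c i|%:R +
    \sum_(s in S :\: color_class X c i) #|nonnbrs G (A i) s|%:R
      <= T%:R * (b * #|S|%:R).
Proof.
move=> symG sA cA sX deg Hc.
have VS : color_class X c i \subset S.
  by apply/subsetP => s; rewrite inE => /andP[/(subsetP sX)].
rewrite -cA; apply: le_trans (sum_nonnbrs_le symG sA deg).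
rewrite [leRHS](big_setID (color_class X c i)) /= lerD2r (setIidPr VS).
rewrite mulr_natr -sumr_const; apply: ler_sum => s; rewrite inE => /andP[sX' /eqP cs].
have := Hc s sX'; rewrite cs -(card_nbrsD G (A i) s) natrD => lt.
have : #|nbrs G (A i) s|%:R <= m%:R :> R by rewrite ler_nat ltnW.
lra.
Qed.

(** The two sides of a K_2(m) in [V] replace part j. Its at most 2m vertices each miss at most
    T/(4m) of any other part, which keeps T/2 >= m common neighbours there. *)
Lemma no_bipartite_blowup (k m T n : nat) (G : rel 'I_n) (S V : {set 'I_n})
    (A : nat -> {set 'I_n}) (j : nat) :
  symmetric G -> (0 < m)%N -> (2 * m <= T)%N ->
  (forall i, (i < k)%N -> A i \subset S /\ #|A i| = T) ->
  (forall i i' a b, (i < k)%N -> (i' < k)%N -> i != i' ->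
     a \in A i -> b \in A i' -> G a b) ->
  V \subset S ->
  (forall s i, s \in V -> (i < k)%N -> i != j -> (4 * m * #|nonnbrs G (A i) s| <= T)%N) ->
  ~ has_blowup k.+1 m G S -> ~ has_blowup 2 m G V.
Proof.
move=> symG m0 mT HA HG sV HV noB [B [HB HBG]]; apply: noB.
have [sB0 cB0] := HB 0%N isT; have [sB1 cB1] := HB 1%N isT.
pose D := B 0%N :|: B 1%N.
have DV : D \subset V by rewrite subUset sB0.
have cD : (#|D| <= 2 * m)%N.
  by rewrite (leq_trans (leq_card_setU _ _).1) // cB0 cB1 addnn mul2n.
pose C i := [set a in A i | nonnbrs G D a == set0].
have CD i a b : a \in C i -> b \in D -> G a b.
  rewrite inE => /andP[_ /eqP/setP/(_ b)]; rewrite !inE => + bD.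
  by rewrite bD /=; case: (G a b).
have cC i : (i < k)%N -> i != j -> (m <= #|C i|)%N.
  move=> ik ij; have [_ cA] := HA i ik.
  have le1 : (#|A i :\: C i| <= \sum_(s in D) #|nonnbrs G (A i) s|)%N.
    rewrite (nonnbrs_double_count _ _ symG) (big_setID (A i :&: C i)) /=.
    apply: leq_trans (leq_addl _ _); rewrite setDIr setDv set0U -sum1_card.
    apply: leq_sum => a; rewrite !inE => /andP[]; rewrite negb_and.
    by move=> /orP[/negP//|h] aA; rewrite lt0n cards_eq0.
  have le2 : (4 * m * \sum_(s in D) #|nonnbrs G (A i) s| <= #|D| * T)%N.
    rewrite big_distrr -sum_nat_const; apply: leq_sum => s sD.
    by apply: HV => //; apply: (subsetP DV).
  have CA : C i \subset A i by apply/subsetP => a; rewrite inE => /andP[].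
  have := cardsDS CA; rewrite cA => E.
  have CT : (#|C i| <= T)%N by rewrite -cA subset_leq_card.
  move: le1 le2 cD E CT mT m0; clear.
  move: #|A i :\: C i| #|C i| #|D| (\sum_(_ in _) _)%N => x y d z.
  nia.
apply: (@has_blowup_leq _ _ _ _ _
  (fun i => if i == k then B 1%N else if i == j then B 0%N else C i)).
  move=> i; rewrite ltnS leq_eqVlt; case: eqP => /= [_ _|_ ik].
    by split; [exact: (subset_trans sB1)|rewrite cB1].
  case: (eqVneq i j) => [_|ij]; first by split; [exact: (subset_trans sB0)|rewrite cB0].
  split; last exact: cC.
  by have [sA _] := HA i ik; apply/subsetP => a; rewrite inE => /andP[/(subsetP sA)].
have CA i a : a \in C i -> a \in A i by rewrite inE => /andP[].
move=> i i' a b; rewrite !ltnS (leq_eqVlt i) (leq_eqVlt i').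
have D0 x : x \in B 0%N -> x \in D by rewrite /D inE => ->.
have D1 x : x \in B 1%N -> x \in D by rewrite /D inE => ->; rewrite orbT.
case: (eqVneq i k) => [e|ik]; case: (eqVneq i' k) => [e'|i'k] //=.
- by move=> _ _; rewrite e e' eqxx.
- move=> _ lt' _; case: (eqVneq i' j) => [_|_]; first by apply: (HBG 1%N 0%N).
  by move=> aB /CD H; rewrite symG; apply: H; apply: D1.
- move=> lt _ _; case: (eqVneq i j) => [_|_]; first by apply: (HBG 0%N 1%N).
  by move=> /CD H bB; apply: H; apply: D1.
move=> lt lt' ne; case: (eqVneq i j) => [e|ij]; case: (eqVneq i' j) => [e'|i'j].
- by move: ne; rewrite e e' eqxx.
- by move=> aB /CD H; rewrite symG; apply: H; apply: D0.
- by move=> /CD H bB; apply: H; apply: D0.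
- by move=> /CA aA /CA bA; apply: (HG i i').
Qed.

Lemma arcs_setD_le (n : nat) (G : rel 'I_n) (V V' : {set 'I_n}) :
  symmetric G -> V' \subset V ->
  (arcs G V <= arcs G V' + 2 * #|V :\: V'| * #|V|)%N.
Proof.
move=> symG sV; rewrite !arcsE (big_setID V') /= (setIidPr sV).
have -> : (\sum_(i in V') \sum_(v in V) G i v =
   \sum_(i in V') \sum_(v in V') G i v + \sum_(i in V') \sum_(v in V :\: V') G i v)%N.
  by rewrite -big_split; apply: eq_bigr => i _; rewrite (big_setID V') /= (setIidPr sV).
rewrite -addnA leq_add2l mul2n -addnn mulnDl; apply: leq_add.
  rewrite mulnC -sum_nat_const; apply: (@leq_trans (\sum_(i in V') #|V :\: V'|)%N).
    apply: leq_sum => i _; rewrite -sum1_card; apply: leq_sum => v _; exact: leq_b1.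
  by rewrite !sum_nat_const leq_mul2r subset_leq_card // orbT.
rewrite -sum_nat_const; apply: leq_sum => i _.
by rewrite -sum1_card; apply: leq_sum => v _; exact: leq_b1.
Qed.

Lemma sum_ord_const (R : realType) (k : nat) (x : R) : \sum_(i < k) x = k%:R * x.
Proof. by rewrite sumr_const card_ord mulr_natl. Qed.

(** Markov's inequality for each part i other than j, summed over i: a vertex of class j lies
    outside class i, so its non-neighbours in [A i] are counted by [B]. *)
Lemma card_far_vertices (R : realType) (k m T n : nat) (G : rel 'I_n)
    (S X : {set 'I_n}) (A : nat -> {set 'I_n}) (c : 'I_n -> 'I_k) (j : 'I_k) (B : R) :
  X \subset S ->
  (forall i : 'I_k,
     \sum_(s in S :\: color_class X c i) #|nonnbrs G (A i) s|%:R <= B) ->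
  #|[set s in color_class X c j |
      [exists i : 'I_k, (i != j) && (T < 4 * m * #|nonnbrs G (A i) s|)%N]]|%:R * T%:R
    <= k%:R * (4 * m%:R * B).
Proof.
move=> sX HB; set Y := [set s in _ | _].
apply: (@le_trans _ _ (\sum_(s in Y) \sum_(i < k | s \notin color_class X c i)
    4 * m%:R * #|nonnbrs G (A i) s|%:R)).
  rewrite mulr_natl -sumr_const; apply: ler_sum => s.
  rewrite inE => /andP[sV /existsP[i /andP[ij lt]]].
  have sVi : s \notin color_class X c i.
    by move: sV; rewrite !inE => /andP[-> /eqP->]; rewrite eq_sym.
  rewrite (bigD1 i) //= -[leLHS]addr0; apply: lerD; last first.
    by apply: sumr_ge0 => i' _; rewrite !mulr_ge0.
  by rewrite -!natrM ler_nat ltnW.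
rewrite (exchange_big_dep xpredT) //= -sum_ord_const.
apply: ler_sum => i _; rewrite -mulr_sumr ler_wpM2l ?mulr_ge0 //.
apply: le_trans (HB i).
rewrite [leRHS](bigID (fun s => s \in Y)) /= -[leLHS]addr0.
apply: lerD; last by apply: sumr_ge0.
apply: (@le_trans _ _ (\sum_(s in S :\: color_class X c i | s \in Y) #|nonnbrs G (A i) s|%:R)) => //.
rewrite le_eqVlt; apply/orP; left; apply/eqP; apply: eq_bigl => s.
rewrite !inE; case: (boolP (s \in X)) => [/(subsetP sX)->|] /=; last by rewrite andbF.
by rewrite andbT andbC.
Qed.

(** Cauchy-Schwarz linearised at y, which will be the expected class size. *)
Lemma sum_sqr_ge (R : realType) (k : nat) (a : 'I_k -> R) (y : R) :
  2 * y * (\sum_i a i) - k%:R * y ^+ 2 <= \sum_i a i ^+ 2.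
Proof.
rewrite mulr_sumr -(sum_ord_const k) -sumrB.
by apply: ler_sum => i _; have := sqr_ge0 (a i - y); lra.
Qed.

(* K_k(T) sits in S; a vertex seeing at least m vertices of every part of it would, in
   large numbers, extend it to K_{k+1}(m), so almost every vertex misses almost all of one
   part, whose index is its colour.  Counting non-edges into a part gives the sizes of the
   colour classes, and the vertices of the other classes then see almost all of that part.
   Hence many edges inside a class would produce K_2(m), and with it K_{k+1}(m). *)
Lemma coloring_of_min_degree (R : realType) (k m : nat) (eta : R) :
  (0 < k)%N -> (0 < m)%N -> 0 < eta ->
  exists2 sigma : R, 0 < sigma &
  exists N0 : nat, forall (n : nat) (G : rel 'I_n) (S : {set 'I_n}),
    symmetric G -> irreflexive G -> (N0 <= #|S|)%N ->
    (forall u, u \in S -> (1 - 1 / k%:R - sigma) * #|S|%:R <= #|nbrs G S u|%:R) ->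
    ~ has_blowup k.+1 m G S ->
    exists (X : {set 'I_n}) (c : 'I_n -> 'I_k), [/\ X \subset S,
      #|S :\: X|%:R <= eta * #|S|%:R,
      forall i, #|color_class X c i|%:R <= (1 / k%:R + eta) * #|S|%:R &
      #|misplaced_pairs G X c|%:R <= eta * #|S|%:R ^+ 2].
Proof.
move=> k0 m0 eta0.
wlog eta1 : eta eta0 / eta <= 1.
  move=> H; pose e' := Num.min eta 1.
  have e'le : e' <= eta by rewrite ge_min lexx.
  have [||s s0 [N0 HN0]] := H e'; first by rewrite lt_min eta0 ltr01.
    by rewrite ge_min lexx orbT.
  exists s => //; exists N0 => n G S symG irrG leS deg nob.
  have [X [c [sX WX cX mX]]] := HN0 n G S symG irrG leS deg nob.
  exists X, c; split=> //.
  - by apply: le_trans WX _; rewrite ler_wpM2r.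
  - by move=> i; apply: le_trans (cX i) _; rewrite ler_wpM2r // lerD2l.
  - by apply: le_trans mX _; rewrite ler_wpM2r // sqr_ge0.
have [th0 [kinv invp]] := one_minus_inv_bounds R k0.
have K1 : 1 <= k%:R :> R by rewrite ler1n.
have M1 : 1 <= m%:R :> R by rewrite ler1n.
have inv1 : 1 / k%:R <= 1 :> R by rewrite -subr_ge0.
set K : R := k%:R in kinv invp th0 inv1 K1 *; set inv := 1 / K in kinv invp th0 inv1 *.
set M : R := m%:R in M1 *.
have K0 : 0 < K by apply: lt_le_trans K1.
have M0 : 0 < M by apply: lt_le_trans M1.
have KM0 : 0 < 64 * K ^+ 2 * M by rewrite !mulr_gt0 // exprn_gt0.
(* There will be at most kap T |S| non-edges between [A i] and the vertices outside class i. The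
   factor 64 K^2 M makes the resulting arcs inside all classes total eta/8, in units of |S|^2; [et]
   adds another eta/16. *)
pose kap := eta / (64 * K ^+ 2 * M).
have kapE : 64 * K ^+ 2 * M * kap = eta by rewrite mulrC divfK // gt_eqF.
have kap0 : 0 < kap by rewrite divr_gt0.
clearbody kap inv.
pose s := inv * kap / 8.
have s0 : 0 < s by rewrite /s divr_gt0 // mulr_gt0.
have KsE : K * s = kap / 8 by rewrite /s mulrA (mulrA K) kinv mul1r.
have skap : s <= kap / 8 by rewrite -KsE ler_peMl // ltW.
have kap_eta : 64 * kap <= eta.
  have KM1 : 1 <= K ^+ 2 * M by rewrite mulr_ege1 // exprn_ege1.
  have : 1 * kap <= K ^+ 2 * M * kap by rewrite ler_wpM2r // ltW.
  by rewrite -kapE; lra.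
have kap_inv : kap <= inv.
  have KM1 : 1 <= K * M by rewrite mulr_ege1.
  have h : K * kap * 1 <= K * kap * (K * M).
    by rewrite ler_wpM2l // mulr_ge0 // ltW.
  have : inv * (K * kap) <= inv * 1.
    rewrite ler_wpM2l ?(ltW invp) //.
    have -> : K * kap = K * kap * 1 by rewrite mulr1.
    have : 64 * (K * kap * (K * M)) = eta by rewrite -kapE; ring.
    by lra.
  by rewrite mulrA (mulrC inv) kinv; lra.
pose et := eta / (16 * K).
have etE : K * et = eta / 16 by rewrite /et; field; rewrite gt_eqF.
have et0 : 0 < et by rewrite divr_gt0 // mulr_gt0.
clearbody s et.
exists s => //.
have [T0 HT0] := natr_ge_exists (2 * M / s).
pose T := (T0 + 4 * m)%N.
have TM : 2 * M <= s * T%:R.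
  by rewrite [leRHS]mulrC -ler_pdivrMr // (le_trans HT0) // ler_nat leq_addr.
have T4M : 4 * M <= T%:R by rewrite -natrM ler_nat leq_addl.
pose b := inv + s.
have [||N1 HN1] := @has_blowup_min_degree R k b _ _ T.
- by rewrite addr_ge0 // ltW.
- have : k.-1%:R = K - 1 by rewrite /K -(prednK k0) -natr1 addrK prednK.
  move=> ->; rewrite /b.
  have -> : (K - 1) * (inv + s) = K * inv + K * s - inv - s by ring.
  by rewrite kinv KsE; lra.
(* For k = 1 the threshold density is 0: large sets without K_2(m) have fewer than [et] times the
   square of their size arcs. *)
have [N2 HN2] := @erdos_stone R 1 et isT et0 m.
have [N3 HN3] := natr_ge_exists (M * (2 ^ (T * k))%:R / s).
have [N4 HN4] := natr_ge_exists (N2%:R ^+ 2 / et).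
exists (N1 + N3 + N4).+1 => n G S symG irrG leS deg nob.
have deg' u : u \in S -> (1 - b) * #|S|%:R <= #|nbrs G S u|%:R.
  by move=> /deg; rewrite /b opprD addrA.
have leN1 : (N1 <= #|S|)%N by apply: leq_trans leS; rewrite leqW // -addnA leq_addr.
have leN3 : N3%:R <= #|S|%:R :> R.
  by rewrite ler_nat; apply: leq_trans leS; rewrite leqW // addnAC leq_addl.
have leN4 : N4%:R <= #|S|%:R :> R.
  by rewrite ler_nat; apply: leq_trans leS; rewrite leqW // leq_addl.
have N1r : 1 <= #|S|%:R :> R by rewrite ler1n (leq_trans _ leS).
have [A [HA HG]] := HN1 n G S symG leN1 deg'.
pose X := [set v in S | [exists i : 'I_k, (#|nbrs G (A i) v| < m)%N]].
(* The default colour occurs only outside [X]. *)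
pose c v : 'I_k := odflt (Ordinal k0) [pick i : 'I_k | (#|nbrs G (A i) v| < m)%N].
have sX : X \subset S by apply/subsetP => v; rewrite inE => /andP[].
have Xc v : v \in X -> (#|nbrs G (A (c v)) v| < m)%N.
  rewrite inE /c => /andP[_ /existsP[i lt]]; case: pickP => // /(_ i).
  by rewrite lt.
have leW : #|S :\: X|%:R <= s * #|S|%:R.
  rewrite leNgt; apply/negP => lt; apply: nob.
  apply: (@has_blowup_extend k m T n G S (S :\: X) A) => //.
  - exact: subsetDl.
  - move=> w i; rewrite !inE => /andP[+ wS] ik; rewrite wS /= negb_exists.
    by move=> /forallP/(_ (Ordinal ik)); rewrite -leqNgt.
  rewrite -(ler_nat R) natrM; apply: le_trans (ltW lt).
  by rewrite [leRHS]mulrC -ler_pdivrMr // (le_trans HN3).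
set N : R := #|S|%:R in leN3 leN4 N1r leW deg deg' *.
pose a (i : 'I_k) : R := #|color_class X c i|%:R.
have VS i : color_class X c i \subset S.
  by apply/subsetP => v; rewrite inE => /andP[/(subsetP sX)].
have a0 i : 0 <= a i by rewrite /a.
have aN i : a i <= N by rewrite ler_nat subset_leq_card.
have dc (i : 'I_k) : (T%:R - M) * a i +
    \sum_(v in S :\: color_class X c i) #|nonnbrs G (A i) v|%:R <= T%:R * (b * N).
  have [sA cA] := HA i (ltn_ord i).
  exact: (@color_class_double_count R b k m T n G S X A c i).
have TT : 0 < T%:R :> R by lra.
have s1 : s <= 1 / 512 by lra.
have aup i : a i <= (inv + 2 * s) * N.
  have h0 : 0 <= \sum_(v in S :\: color_class X c i) #|nonnbrs G (A i) v|%:R :> R.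
    by apply: sumr_ge0.
  have h1 : (T%:R - M) * a i <= T%:R * (b * N) by apply: le_trans (dc i); rewrite lerDl.
  have TMp : 0 < T%:R - M by clear -T4M M1; lra.
  rewrite -(ler_pM2l TMp); apply: (le_trans h1).
  rewrite mulrA [leRHS]mulrA ler_wpM2r ?(le_trans ler01) // /b.
  have : M * (inv + 2 * s) <= M * 2 by rewrite ler_wpM2l //; clear -inv1 s1 M1; lra.
  clear -TM; lra.
have N0 : 0 <= N by apply: le_trans N1r.
have sN0 : 0 <= s * N by rewrite mulr_ge0 // ltW.
have sumA : \sum_i a i = #|X|%:R by rewrite -natr_sum sum_card_color_class.
have cX : #|X|%:R = N - #|S :\: X|%:R.
  by rewrite cardsDS // natrB ?subset_leq_card // opprB addrC subrK.
(* The classes sum to at least (1 - s) N and none exceeds (inv + 2 s) N, so none falls far below the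
   average. *)
have alo i : (inv - 2 * K * s) * N <= a i.
  have : (inv + 2 * s) * N - a i <= \sum_j ((inv + 2 * s) * N - a j).
    rewrite [leRHS](bigD1 i) //= lerDl; apply: sumr_ge0 => j _.
    by rewrite subr_ge0.
  rewrite sumrB sumA cX sum_ord_const -/K.
  have -> : K * ((inv + 2 * s) * N) = (K * inv) * N + 2 * K * s * N by ring.
  by rewrite kinv; clear -leW sN0; lra.
have Bup i : \sum_(v in S :\: color_class X c i) #|nonnbrs G (A i) v|%:R
    <= T%:R * (kap * N).
  apply: le_trans (_ : T%:R * (b * N) - (T%:R - M) * a i <= _).
    by have := dc i; clear -M1; lra.
  have h1 : T%:R * ((inv - 2 * K * s) * N) <= T%:R * a i by rewrite ler_pM2l.
  have h2 : M * a i <= M * N by rewrite ler_wpM2l // (le_trans ler01).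
  have h3 : 2 * M * N <= s * T%:R * N by rewrite ler_wpM2r // (le_trans ler01).
  have h4 : (s * 3 / 2 + 2 * (K * s)) * (T%:R * N) <= kap * (T%:R * N).
    by rewrite ler_wpM2r ?mulr_ge0 // KsE; clear -skap kap0; lra.
  by rewrite /b; clear -h1 h2 h3 h4; lra.
have arcsV j : (arcs G (color_class X c j))%:R <= (et + 8 * K * M * kap) * N ^+ 2.
  set V := color_class X c j.
  pose Y := [set v in V |
      [exists i : 'I_k, (i != j) && (T < 4 * m * #|nonnbrs G (A i) v|)%N]].
  have cY : #|Y|%:R <= 4 * K * M * kap * N.
    have := card_far_vertices m T j sX Bup; rewrite -/V -/Y -/K -/M => h.
    by rewrite -(ler_pM2r TT); apply: (le_trans h); rewrite le_eqVlt; apply/orP; left; apply/eqP; ring.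
  have sV' : V :\: Y \subset V by apply: subsetDl.
  have YV : Y \subset V by apply/subsetP => v; rewrite inE => /andP[].
  have cV' : #|V :\: Y|%:R <= N by rewrite ler_nat; apply/subset_leq_card/(subset_trans sV')/VS.
  have arcsV' : (arcs G (V :\: Y))%:R <= et * N ^+ 2.
    have nob2 : ~ has_blowup 2 m G (V :\: Y).
      apply: (@no_bipartite_blowup k m T n G S _ A j) => //.
      - by rewrite (leq_trans _ (leq_addl _ _)) // leq_mul2r orbT.
      - exact: subset_trans sV' (VS j).
      move=> v i; rewrite !inE => /andP[+ vV] ik ij; rewrite vV /= negb_exists.
      move=> /forallP/(_ (Ordinal ik)); rewrite negb_and -leqNgt /= => /orP[|//].
      by rewrite negbK => /eqP e; move: ij; rewrite -e eqxx.
    have [lt|ge] := ltnP #|V :\: Y| N2.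
      apply: (@le_trans _ _ (N2%:R ^+ 2)).
        rewrite -natrX ler_nat; apply: leq_trans (arcs_le_sqr _ _) _.
        by rewrite leq_exp2r // ltnW.
      move: HN4; rewrite ler_pdivrMr // => HN4; apply: (le_trans HN4).
      rewrite mulrC ler_pM2l //; apply: (le_trans leN4); rewrite expr2.
      by rewrite ler_peMl // (le_trans ler01).
    rewrite leNgt; apply/negP => lt; apply: nob2; apply: HN2 => //.
    apply: le_trans (ltW lt); rewrite divr1 subrr add0r ler_pM2l //.
    by rewrite ler_pXn2r // nnegrE // (le_trans ler01).
  have := arcs_setD_le symG sV'; rewrite -/V -(ler_nat R) natrD !natrM.
  have -> : V :\: (V :\: Y) = Y by rewrite setDDr setDv set0U; apply/setIidPr.
  move=> h; apply: (le_trans h).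
  have h1 : #|Y|%:R * #|V|%:R <= (4 * K * M * kap * N) * N.
    by apply: ler_pM => //; exact: (aN j).
  by move: arcsV' h1; rewrite expr2; clear -M1; lra.
exists X, c; split=> //.
- by apply: (le_trans leW); rewrite ler_wpM2r //; clear -skap kap_eta kap0; lra.
- by move=> i; apply: (le_trans (aup i)); rewrite ler_wpM2r //; clear -skap kap_eta kap0; lra.
have nonX : (\sum_(x in X) #|nonnbrs G X x|)%:R <= N * (b * N) :> R.
  rewrite /N; apply: le_trans (sum_nonnbrs_le symG (subxx S) deg').
  rewrite -natr_sum ler_nat [leqRHS](big_setID X) /= (setIidPr sX).
  apply: leq_trans (leq_addr _ _); apply: leq_sum => x _.
  by apply: subset_leq_card; apply/subsetP => y; rewrite !inE => /andP[/andP[-> _] ->].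
have sumarcs : (\sum_(i < k) arcs G (color_class X c i))%:R <=
    K * ((et + 8 * K * M * kap) * N ^+ 2).
  rewrite natr_sum -[K in leRHS]/(k%:R) -(sum_ord_const k).
  by apply: ler_sum => i _; apply: arcsV.
(* The main terms cancel: non-edges number at most (1/k + s) N^2, while the squared class sizes sum
   to nearly N^2/k. *)
have := card_misplaced_pairs G X c => /(congr1 (fun x => x%:R : R)).
rewrite natrD [RHS]natrD natrM [X in _ + X = _]natr_sum.
have := sum_sqr_ge a (inv * N); rewrite -/K sumA cX.
have -> : \sum_i a i ^+ 2 = \sum_(i < k) (#|color_class X c i| ^ 2)%:R.
  by apply: eq_bigr => i _; rewrite natrX.
move: sumarcs nonX leW.
have -> : K * ((et + 8 * K * M * kap) * N ^+ 2) = (K * et + 64 * K ^+ 2 * M * kap / 8) * N ^+ 2.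
  by field.
have -> : K * (inv * N) ^+ 2 = (K * inv) * inv * N ^+ 2 by ring.
rewrite kapE etE kinv /b.
move: (\sum_(i < k) _%:R) (\sum_(i < k) _)%:R (\sum_(x in X) _)%:R #|S :\: X|%:R #|misplaced_pairs G X c|%:R.
move=> q1 q2 q3 w d h1 h2 h3 h4 h5.
have : inv * N * w <= inv * N * (s * N).
  by rewrite ler_wpM2l // mulr_ge0 // ltW.
have h6 : inv * (s * N ^+ 2) <= 1 * (s * N ^+ 2).
  by rewrite ler_wpM2r // mulr_ge0 // ?sqr_ge0 // ltW.
have h7 : (3 * s + 3 / 8 * eta) * N ^+ 2 <= eta * N ^+ 2.
  by rewrite ler_wpM2r ?sqr_ge0 //; clear -skap kap_eta kap0; lra.
by clear -h1 h2 h3 h4 h5 h6 h7; lra.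
Qed.

(** Maximising with a density s/2 below Turan's leaves an excess of about (s/2) n^2 in S;
    Erdos-Stone caps it near (s/2) |S|^2, so S is almost everything. *)
Lemma dense_subgraph_of_arcs (R : realType) (k m : nat) (s g : R) :
  (0 < k)%N -> 0 < s -> 0 < g ->
  exists2 delta : R, 0 < delta &
  exists N0 : nat, forall (n : nat) (G : rel 'I_n),
    symmetric G -> irreflexive G -> (N0 <= n)%N -> ~ has_blowup k.+1 m G [set: 'I_n] ->
    (1 - 1 / k%:R - delta) * n%:R ^+ 2 <= (arcs G [set: 'I_n])%:R ->
    exists S : {set 'I_n}, (1 - g) * n%:R <= #|S|%:R /\
      forall u, u \in S -> (1 - 1 / k%:R - s) * #|S|%:R <= #|nbrs G S u|%:R.
Proof.
move=> k0 s0 g0.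
wlog g1 : g g0 / g <= 1.
  move=> H; have [||d d0 [N0 HN0]] := H (Num.min g 1).
  - by rewrite lt_min g0 ltr01.
  - by rewrite ge_min lexx orbT.
  exists d => //; exists N0 => n G symG irrG le nob e.
  have [S [cS deg]] := HN0 n G symG irrG le nob e; exists S; split=> //.
  by apply: le_trans cS; rewrite ler_wpM2r // lerD2l lerN2 ge_min lexx.
have [th0 [kinv invp]] := one_minus_inv_bounds R k0.
have inv1 : 1 / k%:R <= 1 :> R by rewrite -subr_ge0.
(* Small enough that (s/2 + d) (1 - g) < s/2 - d. *)
pose d := g * s / 8; have d0 : 0 < d by rewrite divr_gt0 // mulr_gt0.
have ds : d <= s / 8 by rewrite /d; nra.
have [N1 HN1] := @erdos_stone R k d k0 d0 m.
have [N3 HN3] := natr_ge_exists (1 / s).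
pose L := (N1 + N3)%N.
have [N2 HN2] := natr_ge_exists ((1 + s / 2) * L%:R ^+ 2 / d).
exists d => //; exists N2.+1 => n G symG irrG le nob e.
have n1 : 1 <= n%:R :> R by rewrite ler1n (leq_trans _ le).
have n0 : 0 <= n%:R :> R by [].
have small : (1 + s / 2) * L%:R ^+ 2 <= d * n%:R ^+ 2.
  rewrite [leRHS]mulrC -ler_pdivrMr //; apply: le_trans HN2 _.
  apply: (@le_trans _ _ n%:R); first by rewrite ler_nat ltnW.
  by rewrite expr2 ler_peMl.
have [S [_ val deg]] := exists_min_degree_subset (1 - 1 / k%:R - s / 2) [set: 'I_n] symG irrG.
rewrite cardsT card_ord in val; exists S.
have val' : (s / 2 - d) * n%:R ^+ 2 <= (arcs G S)%:R - (1 - 1 / k%:R - s / 2) * #|S|%:R ^+ 2.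
  by apply: le_trans val; lra.
have x0 : 0 <= #|S|%:R :> R by [].
have n2 : 0 < n%:R ^+ 2 :> R by rewrite exprn_gt0 // (lt_le_trans ltr01).
have big : (L <= #|S|)%N.
  rewrite leqNgt; apply/negP => lt.
  have lt2 : #|S|%:R ^+ 2 <= L%:R ^+ 2 :> R by rewrite -!natrX ler_nat leq_exp2r // ltnW.
  have h1 : (1 / k%:R + s / 2) * #|S|%:R ^+ 2 <= (1 + s / 2) * L%:R ^+ 2.
    by apply: ler_pM; rewrite ?sqr_ge0 //; lra.
  have h2 : d * n%:R ^+ 2 < (s / 2 - d) * n%:R ^+ 2 by rewrite ltr_pM2r //; lra.
  have := arcs_le_sqr G S; rewrite -(ler_nat R) natrX; lra.
have cS : (N1 <= #|S|)%N by apply: leq_trans big; apply: leq_addr.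
have c3 : 1 / s <= #|S|%:R.
  by apply: (le_trans HN3); rewrite ler_nat; apply: leq_trans big; apply: leq_addl.
split; last first.
  move=> u /deg; apply: le_trans; move: c3; rewrite ler_pdivrMr //; lra.
rewrite leNgt; apply/negP => lt; apply: nob.
apply: (has_blowupS (finset.subsetT S)); apply: HN1 => //; rewrite leNgt; apply/negP => few.
have lt2 : #|S|%:R ^+ 2 <= ((1 - g) * n%:R) ^+ 2 :> R.
  have gn : 0 <= (1 - g) * n%:R by rewrite mulr_ge0 // subr_ge0.
  by apply: lerXn2r; rewrite ?nnegrE // ltW.
have h1 : (1 - g) * ((1 - g) * n%:R ^+ 2) <= 1 * ((1 - g) * n%:R ^+ 2).
  by rewrite ler_wpM2r ?mulr_ge0 ?(ltW n2) ?subr_ge0 //; lra.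
have h2 : (s / 2 + d) * #|S|%:R ^+ 2 <= (s / 2 + d) * ((1 - g) * n%:R ^+ 2).
  rewrite ler_wpM2l //; first by lra.
  by apply: (le_trans lt2); rewrite exprMn; lra.
have h3 : 0 < g * d * n%:R ^+ 2 by rewrite mulr_gt0 // mulr_gt0.
have dE : g * s = 8 * d by rewrite /d; field.
have h4 : g * s * n%:R ^+ 2 = 8 * d * n%:R ^+ 2 by rewrite dE.
have h5 : 0 < d * n%:R ^+ 2 by rewrite mulr_gt0.
by clear -val' few h2 h3 h4 h5; lra.
Qed.

(** * Fitting a colouring to the Turan graph *)

Lemma card_residue_class (n k i : nat) : (i < k)%N ->
  (n %/ k <= #|[set x : 'I_n | x %% k == i]%N|)%N.
Proof.
move=> ik; rewrite -[X in (X <= _)%N]card_ord.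
have lt (q : 'I_(n %/ k)) : (q * k + i < n)%N.
  apply: (@leq_trans (q.+1 * k)); first by rewrite mulSn addnC ltn_add2r.
  by apply: leq_trans (leq_divM n k); rewrite leq_mul2r ltn_ord orbT.
pose f (q : 'I_(n %/ k)) : 'I_n := Ordinal (lt q).
have injf : injective f.
  move=> q q' /(congr1 val) /= /eqP; rewrite eqn_add2r eqn_pmul2r ?(leq_trans _ ik) //.
  by move/eqP/val_inj.
rewrite -(card_imset predT injf); apply: subset_leq_card.
apply/subsetP => x /imsetP[q _ ->]; rewrite inE /= modnMDl modn_small //.
Qed.

(* A permutation placing as many vertices as possible in the prescribed residue class: if v
   is misplaced and some w occupies its class wrongly, exchanging their images does better. *)
Lemma exists_matching_perm (n k : nat) (c : 'I_n -> 'I_k) :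
  exists p : {perm 'I_n},
    (#|[set v | (p v %% k)%N != c v]| <= \sum_(i < k) (#|[set v | c v == i]| - n %/ k))%N.
Proof.
pose good (p : {perm 'I_n}) := #|[set v | (p v %% k)%N == c v]|.
case: (arg_maxnP (P := xpredT) good (i0 := 1%g)) => // p _ max; exists p.
rewrite -sum1dep_card (partition_big c xpredT) //=; apply: leq_sum => i _.
rewrite sum1dep_card; set M := [set v | _].
have [->|[v]] := set_0Vmem M; first by rewrite cards0.
rewrite inE => /andP[vbad /eqP cv].
have full (x : 'I_n) : (x %% k)%N == i -> c (p^-1 x)%g == i.
  move=> xi; apply/negPn/negP => cw; set w := (p^-1 x)%g in cw.
  have pw : p w = x by rewrite /w permKV.
  have : (good (tperm v w * p)%g <= good p)%N := max _ isT.
  rewrite leqNgt => /negP; apply.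
  have vw : v != w by apply: contraNneq cw => <-; rewrite cv.
  apply: proper_card; apply/properP; split.
    apply/subsetP => y; rewrite !inE permM; case: tpermP => [->|->|_ _ //].
      by rewrite (negbTE vbad).
    by rewrite pw (eqP xi) => /eqP/val_inj e; rewrite -e eqxx in cw.
  exists v; first by rewrite inE permM tpermL pw cv.
  by rewrite inE (negbTE vbad).
have E : (#|M| + #|[set v | (c v == i) && ((p v %% k)%N == c v)]| = #|[set v | c v == i]|)%N.
  rewrite -cardsUI (_ : _ :&: _ = set0) ?cards0 ?addn0.
    by apply: eq_card => y; rewrite !inE; case: (c y == i); rewrite ?andbF ?andbT //= orNb.
  by apply/setP => y; rewrite !inE; case: (c y == i); rewrite ?andbF ?andbT //= andNb.
(* By [full], every position of residue i is held by a vertex of colour i. *)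
rewrite -E; set Y := [set _ | _]; suff : (n %/ k <= #|Y|)%N.
  by move: #|M| #|Y| (n %/ k)%N => x y z; lia.
apply: leq_trans (card_residue_class n (ltn_ord i)) _.
rewrite -(card_imset _ (@perm_inj _ p^-1%g)); apply: subset_leq_card.
apply/subsetP => w /imsetP[x]; rewrite inE => xi ->.
by have ci := full x xi; rewrite inE ci /= permKV (eqP ci).
Qed.

Lemma close_to_turan_of_arcs (R : realType) (k m : nat) (eps : R) :
  (0 < k)%N -> (0 < m)%N -> 0 < eps ->
  exists2 delta : R, 0 < delta &
  exists N0 : nat, forall (n : nat) (G : rel 'I_n),
    symmetric G -> irreflexive G -> (N0 <= n)%N -> ~ has_blowup k.+1 m G [set: 'I_n] ->
    (1 - 1 / k%:R - delta) * n%:R ^+ 2 <= (arcs G [set: 'I_n])%:R ->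
    close_to G (turan n k) eps.
Proof.
move=> k0 m0 eps0.
have K0 : 0 < k%:R :> R by rewrite ltr0n.
(* Misplaced pairs cost eta n^2, and the at most (2 + 4k) eta n bad vertices cost up to 2n pairs
   each. *)
pose eta := eps / (5 + 8 * k%:R).
have den0 : 0 < 5 + 8 * k%:R :> R by lra.
have eta0 : 0 < eta by rewrite divr_gt0.
have etaE : (5 + 8 * k%:R) * eta = eps by rewrite mulrC divfK // gt_eqF.
have [s s0 [N1 HN1]] := coloring_of_min_degree k0 m0 eta0.
pose g := Num.min eta (1 / 2).
have g0 : 0 < g by rewrite lt_min eta0 divr_gt0.
have g_eta : g <= eta by rewrite ge_min lexx.
have g12 : g <= 1 / 2 by rewrite ge_min lexx orbT.
have [d d0 [N2 HN2]] := @dense_subgraph_of_arcs R k m s g k0 s0 g0.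
have [N3 HN3] := natr_ge_exists (1 / eta).
exists d => //; exists (N2 + 2 * N1 + N3)%N => n G symG irrG len nob e.
have [|S [cS deg]] := HN2 n G symG irrG _ nob e.
  by apply: leq_trans len; rewrite -addnA leq_addr.
have nN3 : 1 <= n%:R * eta.
  rewrite -ler_pdivrMr //; apply: (le_trans HN3); rewrite ler_nat.
  by apply: leq_trans len; apply: leq_addl.
have n0 : 0 <= n%:R :> R by [].
have Sn : #|S|%:R <= n%:R :> R by rewrite ler_nat -[leqRHS](card_ord n) max_card.
have [||X [c [sX cSX cV cM]]] := HN1 n G S symG irrG _ deg.
- have : 2 * N1%:R <= n%:R :> R.
    rewrite -natrM ler_nat; apply: leq_trans len.
    by rewrite (addnC N2) -addnA leq_addr.
  have : g * n%:R <= 1 / 2 * n%:R by rewrite ler_wpM2r.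
  rewrite -(ler_nat R); lra.
- by move/(has_blowupS (finset.subsetT S)).
have eS : eta * #|S|%:R <= eta * n%:R by rewrite ler_wpM2l // ltW.
have gn : g * n%:R <= eta * n%:R by rewrite ler_wpM2r.
have cCX : #|~: X|%:R <= 2 * eta * n%:R.
  have : (#|~: X| = #|~: S| + #|S :\: X|)%N.
    rewrite -(cardsID S (~: X)) addnC; congr (_ + _)%N; apply: eq_card => v; rewrite !inE //.
    by case: (boolP (v \in X)) => [/(subsetP sX)->|_] //=; rewrite ?andbT.
  move/(congr1 (fun x => x%:R : R)); rewrite natrD => ->.
  have : #|S|%:R + #|~: S|%:R = n%:R :> R by rewrite -natrD cardsC card_ord.
  lra.
have [p Hp] := exists_matching_perm c; exists p.
set B := [set v | _] in Hp.
(* A colour exceeds n/k by at most eta n inside [X] and 2 eta n outside; rounding n/k down costs 1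
   <= eta n more. *)
have cB : #|B|%:R <= 4 * k%:R * eta * n%:R.
  move: Hp; rewrite -(ler_nat R) natr_sum => Hp; apply: (le_trans Hp).
  apply: (@le_trans _ _ (\sum_(i < k) 4 * eta * n%:R)); last first.
    by rewrite sum_ord_const le_eqVlt; apply/orP; left; apply/eqP; ring.
  apply: ler_sum => i _.
  have c1 : #|[set v | c v == i]|%:R <= #|color_class X c i|%:R + #|~: X|%:R :> R.
    rewrite -natrD ler_nat; apply: leq_trans (leq_card_setU _ _).1.
    apply: subset_leq_card; apply/subsetP => v; rewrite !inE => ->.
    by case: (v \in X).
  have c2 : n%:R / k%:R <= (n %/ k)%:R + 1 :> R.
    by rewrite ler_pdivrMr // natr1 -natrM ler_nat ltnW // ltn_ceil.
  have c3 : 1 / k%:R * #|S|%:R <= n%:R / k%:R :> R.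
    by rewrite mul1r mulrC ler_wpM2r // invr_ge0 ltW.
  have [le|lt] := leqP #|[set v | c v == i]| (n %/ k).
    by rewrite (eqP le) mulr_ge0 // mulr_ge0 // ltW.
  rewrite natrB ?(ltnW lt) //; have := cV i; lra.
pose Bad := ~: X :|: B.
have cBad : #|Bad|%:R <= (2 + 4 * k%:R) * eta * n%:R.
  apply: (@le_trans _ _ (#|~: X|%:R + #|B|%:R)); last by lra.
  by rewrite -natrD ler_nat (leq_card_setU _ _).1.
have edit : (edit_distance_via G (turan n k) p <= #|misplaced_pairs G X c| + 2 * (#|Bad| * n))%N.
  apply: (@leq_trans #|misplaced_pairs G X c :|:
      (setX Bad [set: 'I_n] :|: setX [set: 'I_n] Bad)|).
    apply: subset_leq_card; apply/subsetP => -[u v]; rewrite !inE /= => /andP[_].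
    rewrite !andbT /turan.
    case: (boolP (u \in X)) => //= uX; case: (boolP (v \in X)) => //= vX; rewrite ?orbT //.
    case: (eqVneq (p u %% k)%N (c u)) => [->|]; rewrite ?orbT //.
    case: (eqVneq (p v %% k)%N (c v)) => [->|]; rewrite ?orbT //.
    by rewrite !orbF.
  apply: leq_trans (leq_card_setU _ _).1 _; rewrite leq_add2l.
  apply: leq_trans (leq_card_setU _ _).1 _.
  by rewrite !cardsX !cardsT card_ord mulnC addnn mul2n.
have M2 : #|misplaced_pairs G X c|%:R <= eta * n%:R ^+ 2.
  apply: (le_trans cM); rewrite ler_wpM2l ?(ltW eta0) //.
  by apply: lerXn2r; rewrite ?nnegrE.
move: edit; rewrite -(ler_nat R) natrD !natrM => edit; apply: (le_trans edit).
have : #|Bad|%:R * n%:R <= (2 + 4 * k%:R) * eta * n%:R * n%:R by rewrite ler_wpM2r.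
by rewrite -etaE; lra.
Qed.

(** * The top eigenvector *)

Definition qform (R : realType) (n : nat) (M : 'M[R]_n) (z : 'rV[R]_n) : R :=
  (z *m M *m z^T) 0 0.

Definition sqnorm (R : realType) (n : nat) (z : 'rV[R]_n) : R := \sum_i z 0 i ^+ 2.

Lemma qformE (R : realType) (n : nat) (M : 'M[R]_n) (z : 'rV[R]_n) :
  qform M z = \sum_i \sum_j M i j * z 0 i * z 0 j.
Proof.
rewrite /qform mxE exchange_big /=; apply: eq_bigr => j _.
by rewrite !mxE mulr_suml; apply: eq_bigr => i _; rewrite (mulrC (M i j)).
Qed.

Lemma sqnorm_ge0 (R : realType) (n : nat) (z : 'rV[R]_n) : 0 <= sqnorm z.
Proof. by apply: sumr_ge0 => i _; rewrite sqr_ge0. Qed.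

Lemma sqnorm_gt0 (R : realType) (n : nat) (z : 'rV[R]_n) : z != 0 -> 0 < sqnorm z.
Proof.
move=> z0; rewrite lt_neqAle sqnorm_ge0 andbT eq_sym psumr_neq0; last first.
  by move=> i _; rewrite sqr_ge0.
apply/hasP; have [i zi] : exists i, z 0 i != 0.
  by apply/rV0Pn.
by exists i; rewrite ?mem_index_enum // /= exprn_even_gt0.
Qed.

Lemma sqnormE (R : realType) (n : nat) (z : 'rV[R]_n) : sqnorm z = (z *m z^T) 0 0.
Proof. by rewrite mxE; apply: eq_bigr => i _; rewrite mxE expr2. Qed.

Lemma qform_bound (R : realType) (n : nat) (M : 'M[R]_n) :
  exists2 C : R, 0 < C & forall z, qform M z <= C * sqnorm z.
Proof.
exists (\sum_i \sum_j `|M i j| + 1).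
  by rewrite ltr_wpDl //; do 2!(apply: sumr_ge0 => ? _).
move=> z; rewrite mulrDl mul1r -[leLHS]addr0; apply: lerD; last exact: sqnorm_ge0.
have le i : z 0 i ^+ 2 <= sqnorm z.
  by rewrite /sqnorm (bigD1 i) //= lerDl; apply: sumr_ge0 => j _; rewrite sqr_ge0.
rewrite qformE mulr_suml; apply: ler_sum => i _; rewrite mulr_suml; apply: ler_sum => j _.
apply: le_trans (ler_norm _) _; rewrite -mulrA normrM ler_wpM2l //.
have [h1 h2] : z 0 i * z 0 j <= sqnorm z /\ - (z 0 i * z 0 j) <= sqnorm z.
  have := le i; have := le j; move: (sqnorm z) => q.
  have := sqr_ge0 (z 0 i + z 0 j); have := sqr_ge0 (z 0 i - z 0 j); split; lra.
by rewrite ler_norml h1 andbT lerNl.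
Qed.

(* Let l be the supremum of the Rayleigh quotient.  Were B = l - M invertible, the positive
   semidefinite form of B would dominate a positive multiple of the squared norm, which
   contradicts the choice of l; hence B has a kernel. *)
Lemma top_eigenvector (R : realType) (n : nat) (M : 'M[R]_n) :
  M^T = M -> (0 < n)%N ->
  exists2 l : R, exists2 y : 'rV[R]_n, y != 0 & y *m M = l *: y &
    forall z, qform M z <= l * sqnorm z.
Proof.
move=> symM n0.
pose E : set R := [set a | exists2 z : 'rV[R]_n, z != 0 & a = qform M z / sqnorm z]%classic.
have [C C0 HC] := qform_bound M.
have supE : has_sup E.
  split.
    have [i _] : exists i : 'I_n, true by exists (Ordinal n0).
    exists (qform M (delta_mx 0 i) / sqnorm (delta_mx 0 i)); exists (delta_mx 0 i) => //.
    by apply/rV0Pn; exists i; rewrite mxE !eqxx oner_eq0.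
  by exists C => _ [z z0 ->]; rewrite ler_pdivrMr ?sqnorm_gt0.
pose l := sup E.
have Hl z : qform M z <= l * sqnorm z.
  have [->|z0] := eqVneq z 0.
    by rewrite /qform /sqnorm mul0mx mul0mx mxE big1 ?mulr0 // => i _; rewrite mxE expr0n.
  rewrite -ler_pdivrMr ?sqnorm_gt0 //; apply: sup_upper_bound => //.
  by exists z.
pose B := l%:M - M.
have symB : B^T = B by rewrite /B linearB /= tr_scalar_mx symM.
have qB z : qform B z = l * sqnorm z - qform M z.
  by rewrite /qform /B mulmxBr mulmxBl mul_mx_scalar -scalemxAl !mxE sqnormE !mxE.
have [Bu|] := boolP (B \in unitmx); last first.
  rewrite -row_free_unit -kermx_eq0 => /rowV0Pn[y /sub_kermxP yB y0].
  exists l => //; exists y => //.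
  by apply/eqP; rewrite -subr_eq0 -mul_mx_scalar -mulmxBr -oppr_eq0 -mulmxN opprB yB.
exfalso; clearbody B.
have [C1 C10 HC1] := qform_bound B.
have [C2 C20 HC2] := qform_bound (invmx B *m (invmx B)^T).
have qB0 z : 0 <= qform B z by rewrite qB subr_ge0.
(* Nonnegativity of the form at z - t zB with t = 1/C1: the quadratic term is at most t |zB|^2, half
   of the linear gain 2t |zB|^2. *)
have nB z : sqnorm (z *m B) <= C1 * qform B z.
  pose t := C1^-1; pose w := z *m B.
  have t0 : 0 < t by rewrite invr_gt0.
  have tC : t * C1 = 1 by rewrite mulVf // gt_eqF.
  have := qB0 (z - t *: w).
  have -> : qform B (z - t *: w) = qform B z - 2 * t * sqnorm w + t ^+ 2 * qform B w.
    have -> : qform B (z - t *: w) =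
        ((z *m B - t *: (w *m B)) *m (z^T - t *: w^T)) 0 0.
      rewrite /qform mulmxBl -scalemxAl; congr ((_ *m _) _ _).
      by rewrite linearB /= linearZ.
    rewrite /qform sqnormE mulmxBl !mulmxBr -!scalemxAl -!scalemxAr.
    have -> : w *m B *m z^T = w *m w^T by rewrite /w (trmx_mul z) symB -!mulmxA.
    rewrite -/w !scalerA; rewrite ?mxE. ring.
  have h1 : t ^+ 2 * qform B w <= t ^+ 2 * (C1 * sqnorm w).
    by rewrite ler_wpM2l // sqr_ge0.
  have h2 : t ^+ 2 * (C1 * sqnorm w) = t * (t * C1) * sqnorm w by ring.
  rewrite tC mulr1 in h2; move=> h3.
  have h4 : t * sqnorm w <= qform B z by lra.
  have : C1 * (t * sqnorm w) <= C1 * qform B z by rewrite ler_wpM2l // ltW.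
  by rewrite mulrA (mulrC C1) tC mul1r.
have nz z : sqnorm z <= C2 * sqnorm (z *m B).
  apply: le_trans (HC2 _); rewrite le_eqVlt; apply/orP; left; apply/eqP.
  rewrite /qform sqnormE.
  have e : z *m B *m invmx B = z by rewrite -mulmxA mulmxV // mulmx1.
  by rewrite mulmxA e -mulmxA -trmx_mul e.
have K0 : 0 < (C2 * C1)^-1 by rewrite invr_gt0 mulr_gt0.
have ub : ubound E (l - (C2 * C1)^-1).
  move=> _ [z z0 ->]; rewrite ler_pdivrMr ?sqnorm_gt0 // mulrBl.
  have h1 : sqnorm z <= C2 * (C1 * qform B z).
    by apply: (le_trans (nz z)); rewrite ler_wpM2l // ltW.
  have h2 : (C2 * C1)^-1 * sqnorm z <= qform B z.
    by rewrite ler_pdivrMl ?mulr_gt0 // -mulrA.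
  by move: h2; rewrite qB; lra.
have := ge_sup supE.1 ub; rewrite -/l; lra.
Qed.

(** * Eigenvector weights *)

(** Vertices outside [S] stay as isolated vertices, so all subsets share one matrix size; they
    contribute only the eigenvalue 0. *)
Definition induced (n : nat) (G : rel 'I_n) (S : {set 'I_n}) : rel 'I_n :=
  fun u v => [&& u \in S, v \in S & G u v].

Lemma sum_nbrs_const (R : realType) (n : nat) (G : rel 'I_n) (S : {set 'I_n})
    (u : 'I_n) (x : R) :
  \sum_(v in S | G u v) x = #|nbrs G S u|%:R * x.
Proof.
rewrite mulr_natl -sumr_const; apply: eq_bigl => v.
by rewrite inE.
Qed.

Lemma sum_nonnbrs_const (R : realType) (n : nat) (G : rel 'I_n) (S : {set 'I_n})
    (u : 'I_n) (x : R) :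
  \sum_(v in S | ~~ G u v) x = #|nonnbrs G S u|%:R * x.
Proof.
rewrite mulr_natl -sumr_const; apply: eq_bigl => v.
by rewrite inE.
Qed.

Lemma sum_nbrs_exchange (R : realType) (n : nat) (G : rel 'I_n) (S : {set 'I_n})
    (f : 'I_n -> R) : symmetric G ->
  \sum_(u in S) \sum_(v in S | G u v) f v = \sum_(u in S) #|nbrs G S u|%:R * f u.
Proof.
move=> symG; rewrite (exchange_big_dep (mem S)) /=; last by move=> u v _ /andP[].
apply: eq_bigr => v vS; rewrite -sum_nbrs_const; apply: eq_bigl => u.
by rewrite vS symG.
Qed.

Lemma sum_nonnbrs_exchange (R : realType) (n : nat) (G : rel 'I_n) (S : {set 'I_n})
    (f : 'I_n -> R) : symmetric G ->
  \sum_(u in S) \sum_(v in S | ~~ G u v) f v = \sum_(u in S) #|nonnbrs G S u|%:R * f u.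
Proof.
move=> symG; rewrite (exchange_big_dep (mem S)) /=; last by move=> u v _ /andP[].
apply: eq_bigr => v vS; rewrite -sum_nonnbrs_const; apply: eq_bigl => u.
by rewrite vS symG.
Qed.

Lemma signless_laplacian_induced_mul (R : realType) (n : nat) (G : rel 'I_n)
    (S : {set 'I_n}) (z : 'rV[R]_n) (u : 'I_n) : symmetric G ->
  (z *m signless_laplacian R (induced G S)) 0 u =
  if u \in S then \sum_(v in S | G u v) (z 0 u + z 0 v) else 0.
Proof.
move=> symG; rewrite mxE.
have E v : z 0 v * signless_laplacian R (induced G S) v u =
   (if v == u then z 0 v * (degree (induced G S) v)%:R else 0) +
   (if [&& u \in S, v \in S & G u v] then z 0 v else 0).
  rewrite !mxE mulrDr; congr (_ + _); first by case: eqP; rewrite ?mulr0.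
  by rewrite /induced (symG v); case: (v \in S); case: (u \in S); case: (G u v); rewrite ?mulr1 ?mulr0.
under eq_bigr do rewrite E; rewrite big_split /= -big_mkcond big_pred1_eq -big_mkcond /=.
case: ifP => uS.
  rewrite big_split sum_nbrs_const /= mulrC; congr (_%:R * _ + _).
  by apply: eq_card => v; rewrite !inE /induced uS.
rewrite big_pred0 // addr0 (_ : degree _ _ = 0%N) ?mulr0 //.
by apply: eq_card0 => v; rewrite !inE /induced uS.
Qed.

Lemma qform_signless_laplacian (R : realType) (n : nat) (G : rel 'I_n)
    (S : {set 'I_n}) (z : 'rV[R]_n) : symmetric G ->
  qform (signless_laplacian R (induced G S)) z =
  \sum_(u in S) \sum_(v in S | G u v) (z 0 u ^+ 2 + z 0 u * z 0 v).
Proof.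
move=> symG; rewrite /qform mxE [RHS]big_mkcond /=; apply: eq_bigr => u _.
rewrite signless_laplacian_induced_mul // [z^T u 0]mxE; case: ifP => _; last by rewrite mul0r.
by rewrite mulr_suml; apply: eq_bigr => v _; ring.
Qed.

(** The supremum is attained: [top_eigenvector] gives an eigenvalue bounding all Rayleigh quotients,
    and every eigenvalue is such a quotient. *)
Lemma q_index_top (R : realType) (n : nat) (H : rel 'I_n) :
  symmetric H -> (0 < n)%N ->
  (exists2 y : 'rV[R]_n, y != 0 & y *m signless_laplacian R H = q_index R H *: y) /\
  forall z, qform (signless_laplacian R H) z <= q_index R H * sqnorm z.
Proof.
move=> symH n0; set M := signless_laplacian R H.
have symM : M^T = M.
  apply/matrixP => i j; rewrite !mxE symH; congr (_ + _).
  by case: eqVneq => [->|].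
have [l [y y0 yl] Hl] := top_eigenvector symM n0.
suff -> : q_index R H = l by split; [exists y|].
have ub : ubound [set a : R | eigenvalue M a]%classic l.
  move=> a /eigenvalueP[v va v0]; have := Hl v.
  by rewrite /qform va -scalemxAl mxE -sqnormE ler_pM2r // sqnorm_gt0.
have lE : [set a : R | eigenvalue M a]%classic l by apply/eigenvalueP; exists y.
apply/eqP; rewrite eq_le; apply/andP; split.
  by apply: ge_sup => //; exists l.
by apply: sup_upper_bound => //; split; exists l.
Qed.

Lemma induced_sym (n : nat) (G : rel 'I_n) (S : {set 'I_n}) :
  symmetric G -> symmetric (induced G S).
Proof. by move=> symG u v; rewrite /induced symG andbCA. Qed.

(* w is the squared unit eigenvector; the last item is the Rayleigh bound for the eigenvector
   with its entry at u erased. *)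
Lemma spectral_weights (R : realType) (n : nat) (G : rel 'I_n) (S : {set 'I_n}) :
  symmetric G -> irreflexive G -> (0 < n)%N -> 0 < q_index R (induced G S) ->
  let q := q_index R (induced G S) in
  exists w : 'I_n -> R, [/\ forall u, 0 <= w u,
    \sum_(u in S) w u = 1,
    q <= 2 * \sum_(u in S) #|nbrs G S u|%:R * w u &
    forall u, u \in S ->
      q * (1 - w u) - ((q - #|nbrs G S u|%:R) * w u + \sum_(v in S | G u v) w v)
        <= q_index R (induced G (S :\ u)) * (1 - w u)].
Proof.
move=> symG irrG n0 q0 q.
have [[y y0 yq] _] := q_index_top R (induced_sym S symG) n0.
rewrite -/q in yq q0; pose p := sqnorm y.
have p0 : 0 < p by apply: sqnorm_gt0.
have eig u : u \in S -> \sum_(v in S | G u v) y 0 v = (q - #|nbrs G S u|%:R) * y 0 u.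
  move=> uS; have := signless_laplacian_induced_mul S y u symG.
  by rewrite yq mxE uS big_split sum_nbrs_const /= => e; rewrite mulrBl e addrAC subrr add0r.
have supp u : u \notin S -> y 0 u = 0.
  move=> uS; have := signless_laplacian_induced_mul S y u symG.
  by rewrite yq mxE (negbTE uS) => /eqP; rewrite mulf_eq0 gt_eqF //= => /eqP.
have pS : \sum_(u in S) y 0 u ^+ 2 = p.
  rewrite /p /sqnorm [RHS](bigID (mem S)) /= [X in _ + X]big1 ?addr0 // => u /supp ->.
  by rewrite expr0n.
have qp : \sum_(u in S) \sum_(v in S | G u v) (y 0 u ^+ 2 + y 0 u * y 0 v) = q * p.
  by rewrite -qform_signless_laplacian // /qform yq -scalemxAl mxE -sqnormE.
exists (fun u => y 0 u ^+ 2 / p); split.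
- by move=> u; rewrite divr_ge0 ?sqr_ge0 // ltW.
- by rewrite -mulr_suml pS divff // gt_eqF.
- rewrite -(ler_pM2r p0) -qp -mulrA mulr_suml.
  under [X in _ <= _ * X]eq_bigr do rewrite -mulrA divfK ?gt_eqF //.
  (* On each arc 2 (y_u^2 + y_u y_v) <= 3 y_u^2 + y_v^2; by symmetry the right side sums to four
     times the degree-weighted squares. *)
  rewrite -(ler_pM2l (ltr0Sn R 1)).
  have -> : 2 * (2 * \sum_(u in S) #|nbrs G S u|%:R * y 0 u ^+ 2) =
     3 * (\sum_(u in S) #|nbrs G S u|%:R * y 0 u ^+ 2) +
     \sum_(u in S) \sum_(v in S | G u v) y 0 v ^+ 2.
    by rewrite (sum_nbrs_exchange S (fun v => y 0 v ^+ 2) symG); ring.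
  rewrite !mulr_sumr -big_split /=; apply: ler_sum => u _.
  rewrite -sum_nbrs_const !mulr_sumr -big_split /=; apply: ler_sum => v _.
  have := sqr_ge0 (y 0 u - y 0 v); lra.
move=> u uS.
have [_ /(_ (\row_v (if v == u then 0 else y 0 v)))] :=
  q_index_top R (induced_sym (S :\ u) symG) n0.
set z := \row_v _; set q' := q_index R _.
have zE v : v != u -> z 0 v = y 0 v by rewrite mxE => /negbTE ->.
have -> : sqnorm z = p - y 0 u ^+ 2.
  rewrite /p /sqnorm (bigD1 u) //= [in RHS](bigD1 u) //= mxE eqxx expr0n add0r.
  by rewrite addrAC subrr add0r; apply: eq_bigr => v /zE ->.
rewrite qform_signless_laplacian //.
pose F a b := y 0 a ^+ 2 + y 0 a * y 0 b.
(* Erasing the entry at u removes the arcs leaving u and those entering u; the eigenvalue equation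
   at u evaluates both sums. *)
have -> : \sum_(a in S :\ u) \sum_(b in S :\ u | G a b) (z 0 a ^+ 2 + z 0 a * z 0 b) =
    q * p - \sum_(b in S | G u b) F u b - \sum_(a in S | G u a) F a u.
  have -> : q * p = \sum_(a in S :\ u) \sum_(b in S | G a b) F a b + \sum_(b in S | G u b) F u b.
    by rewrite -qp (big_setD1 u uS) addrC.
  rewrite addrK.
  have -> : \sum_(a in S | G u a) F a u = \sum_(a in S :\ u) (if G u a then F a u else 0).
    rewrite big_mkcondr /= (big_setD1 u) //= irrG add0r //.
  rewrite -sumrB; apply: eq_bigr => a; rewrite !inE => /andP[au aS].
  rewrite !big_mkcondr /= [X in _ = X - _](big_setD1 u) //= symG addrAC subrr add0r.
  by apply: eq_bigr => b; rewrite !inE => /andP[bu _]; rewrite !zE.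
have -> : \sum_(b in S | G u b) F u b = q * y 0 u ^+ 2.
  by rewrite big_split sum_nbrs_const -mulr_sumr eig //=; ring.
have -> : \sum_(a in S | G u a) F a u =
    (q - #|nbrs G S u|%:R) * y 0 u ^+ 2 + \sum_(v in S | G u v) y 0 v ^+ 2.
  by rewrite big_split /= -mulr_suml eig // addrC; ring.
move=> h; rewrite -mulr_suml -(ler_pM2r p0).
have pn : p != 0 by rewrite gt_eqF.
move: (\sum_(v in S | _) _) h => s h.
have -> : q' * (1 - y 0 u ^+ 2 / p) * p = q' * (p - y 0 u ^+ 2) by field.
apply: le_trans h; rewrite le_eqVlt; apply/orP; left; apply/eqP; field => //.
Qed.

Lemma q_index_induced_le (R : realType) (n : nat) (G : rel 'I_n) (S : {set 'I_n}) :
  symmetric G -> irreflexive G -> (0 < n)%N ->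
  q_index R (induced G S) <= 2 * #|S|%:R.
Proof.
move=> symG irrG n0; have [le|q0] := leP (q_index R (induced G S)) 0.
  by apply: (le_trans le); rewrite mulr_ge0.
have [w [w0 w1 hq _]] := spectral_weights symG irrG n0 q0.
apply: (le_trans hq); rewrite ler_pM2l //.
apply: (@le_trans _ _ (#|S|%:R * \sum_(u in S) w u)); last by rewrite w1 mulr1.
rewrite mulr_sumr.
apply: ler_sum => u _; rewrite ler_wpM2r // ler_nat.
by rewrite -(card_nbrsD G S u) leq_addr.
Qed.

(* f = w - 1/N satisfies (q - D) f + A f = r with small r, that is (q I - L) f = r for the
   Laplacian L = D - A.  Since f sums to zero, A f may be replaced by minus the sum over
   non-neighbours, and then q > N makes the diagonal dominant. *)
Lemma weights_near_uniform (R : realType) (n : nat) (G : rel 'I_n) (S : {set 'I_n})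
    (w : 'I_n -> R) (q c : R) :
  symmetric G -> (0 < #|S|)%N -> \sum_(u in S) w u = 1 ->
  #|S|%:R <= q ->
  (forall u, u \in S ->
     (1 - c) * q / #|S|%:R <= (q - #|nbrs G S u|%:R) * w u + \sum_(v in S | G u v) w v) ->
  (q - #|S|%:R) * \sum_(u in S) `|w u - 1 / #|S|%:R| <= 2 * c * q.
Proof.
move=> symG S0 w1 qS HL; set N : R := #|S|%:R in qS HL *.
have N0 : 0 < N by rewrite ltr0n.
have Nn : N != 0 by rewrite gt_eqF.
pose f u := w u - 1 / N; pose d u : R := #|nbrs G S u|%:R.
pose r u := (q - d u) * f u + \sum_(v in S | G u v) f v.
have sumN x : \sum_(u in S) x = N * x :> R by rewrite sumr_const mulr_natl.
have sf : \sum_(u in S) f u = 0 by rewrite sumrB w1 sumN mulrCA divff // mulr1 subrr.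
have rE u : r u = (q - d u) * w u + \sum_(v in S | G u v) w v - q / N.
  by rewrite /r /f sumrB sum_nbrs_const -/(d u); field.
have sr : \sum_(u in S) r u = 0.
  rewrite big_split /= sum_nbrs_exchange // -big_split /=.
  under eq_bigr => u _ do rewrite -/(d u) -mulrDl subrK.
  by rewrite -mulr_sumr sf mulr0.
have dN u : d u + #|nonnbrs G S u|%:R = N by rewrite -natrD card_nbrsD.
have cq : 0 <= 2 * c * q / N.
  have h : \sum_(u in S) (r u + c * q / N) >= 0.
    by apply: sumr_ge0 => u /HL; rewrite rE; lra.
  move: h; rewrite big_split /= sr add0r sumN => h.
  have h1 : N * (c * q / N) / N >= 0 by rewrite divr_ge0 // ltW.
  have -> : 2 * c * q / N = 2 * (N * (c * q / N) / N) by field.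
  by rewrite mulr_ge0.
(* A one-sided bound suffices: as [r] sums to zero, the right sides add up to only 2 c q. *)
have nr u : u \in S -> `|r u| <= r u + 2 * c * q / N.
  move=> /HL; rewrite rE => h; rewrite ler_norml; apply/andP; split; lra.
have pt u : u \in S ->
    (q - d u) * `|f u| <= r u + 2 * c * q / N + \sum_(v in S | ~~ G u v) `|f v|.
  move=> uS; have qd : 0 <= q - d u.
    by have := dN u; have := ler0n R #|nonnbrs G S u|; lra.
  have e : (q - d u) * f u = r u + \sum_(v in S | ~~ G u v) f v.
    rewrite /r; move: sf; rewrite (bigID (G u)) /= => sf'.
    by rewrite -addrA sf' addr0.
  rewrite -{1}(ger0_norm qd) -normrM e; apply: le_trans (ler_normD _ _) _.
  by apply: lerD; [exact: nr|exact: ler_norm_sum].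
(* After exchanging the double sum, [f u] has coefficient (q - d) - (N - d) = q - N. *)
have : \sum_(u in S) (q - d u) * `|f u| <=
    \sum_(u in S) (r u + 2 * c * q / N + \sum_(v in S | ~~ G u v) `|f v|).
  by apply: ler_sum => u; apply: pt.
rewrite big_split /= [X in _ <= X + _]big_split /= sr add0r sumN (sum_nonnbrs_exchange S (fun v => `|f v|) symG).
rewrite -lerBlDr -sumrB => h.
have -> : 2 * c * q = N * (2 * c * q / N) by field.
apply: le_trans h; rewrite mulr_sumr; apply: ler_sum => u _.
by have := dN u; rewrite -/(f u) => <-; rewrite le_eqVlt; apply/orP; left; apply/eqP; ring.
Qed.

(** The factor 6/5 gives q - |S| >= q/6, so the weights are within 12 c of uniform in l1 norm;
    replacing them by 1/|S| changes the mean degree by at most 12 c |S|. *)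
Lemma arcs_ge_of_weights (R : realType) (n : nat) (G : rel 'I_n) (S : {set 'I_n})
    (w : 'I_n -> R) (q c : R) :
  symmetric G -> (0 < #|S|)%N -> \sum_(u in S) w u = 1 ->
  6 / 5 * #|S|%:R <= q ->
  q <= 2 * \sum_(u in S) #|nbrs G S u|%:R * w u ->
  (forall u, u \in S ->
     (1 - c) * q / #|S|%:R <= (q - #|nbrs G S u|%:R) * w u + \sum_(v in S | G u v) w v) ->
  (q / #|S|%:R / 2 - 12 * c) * #|S|%:R ^+ 2 <= (arcs G S)%:R.
Proof.
move=> symG S0 w1 qS hq HL.
have N0 : 0 < #|S|%:R :> R by rewrite ltr0n.
have Sq : #|S|%:R <= q by lra.
have := weights_near_uniform symG S0 w1 Sq HL.
set N : R := #|S|%:R in qS HL N0 Sq *; set Y := \sum_(u in S) `|_|.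
have Y0 : 0 <= Y by apply: sumr_ge0.
move=> hY; have {}hY : Y <= 12 * c.
  have : (q / 6) * Y <= (q - N) * Y by rewrite ler_wpM2r //; lra.
  move=> h; have : q * Y <= q * (12 * c) by lra.
  by rewrite ler_pM2l //; lra.
have : \sum_(u in S) #|nbrs G S u|%:R * w u <= (arcs G S)%:R / N + N * Y.
  rewrite /arcs natr_sum mulr_suml mulr_sumr -big_split /=; apply: ler_sum => u _.
  have -> : #|nbrs G S u|%:R * w u =
     #|nbrs G S u|%:R / N + #|nbrs G S u|%:R * (w u - 1 / N) by field; rewrite gt_eqF.
  rewrite lerD2l; apply: (@le_trans _ _ (#|nbrs G S u|%:R * `|w u - 1 / N|)).
    by rewrite ler_wpM2l // ler_norm.
  by rewrite ler_wpM2r // ler_nat -(card_nbrsD G S u) leq_addr.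
move=> h; have h2 : N * Y <= N * (12 * c) by rewrite ler_pM2l.
have h3 : q <= 2 * ((arcs G S)%:R / N) + 2 * N * (12 * c) by lra.
have : N * q <= N * (2 * ((arcs G S)%:R / N) + 2 * N * (12 * c)) by rewrite ler_pM2l.
have -> : N * (2 * ((arcs G S)%:R / N) + 2 * N * (12 * c)) =
   2 * (arcs G S)%:R + 24 * c * N ^+ 2 by field; rewrite gt_eqF.
have -> : (q / N / 2 - 12 * c) * N ^+ 2 = N * q / 2 - 12 * c * N ^+ 2.
  by field; rewrite gt_eqF.
lra.
Qed.

(** * Vertex deletion *)

Definition harmonic_sum (R : realType) (n : nat) : R := \sum_(i < n) i.+1%:R^-1.

Lemma harmonic_sumS (R : realType) (n : nat) :
  harmonic_sum R n.+1 = harmonic_sum R n + n.+1%:R^-1.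
Proof. by rewrite /harmonic_sum big_ord_recr. Qed.

Lemma harmonic_sum_ge (R : realType) (m d n : nat) : (m + d <= n)%N ->
  d%:R / n%:R <= harmonic_sum R (m + d) - harmonic_sum R m.
Proof.
elim: d => [|d IH] le; first by rewrite mul0r addn0 subrr.
rewrite addnS harmonic_sumS -natr1 mulrDl mul1r addrAC lerD //.
  by apply: IH; apply: leq_trans le; rewrite addnS.
by rewrite lef_pV2 ?posrE ?ltr0n ?ler_nat // -?addnS // (leq_trans _ le) // addnS.
Qed.

Lemma harmonic_sum_mono (R : realType) (m n : nat) : (m <= n)%N ->
  harmonic_sum R m <= harmonic_sum R n.
Proof.
move=> mn; have := @harmonic_sum_ge R m (n - m) n; rewrite subnKC // => /(_ (leqnn _)).
by move=> h; rewrite -subr_ge0 (le_trans _ h) // divr_ge0.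
Qed.

Lemma harmonic_sum_unbounded (R : realType) (x : R) : exists n, x <= harmonic_sum R n.
Proof.
have pow j : j%:R / 2 <= harmonic_sum R (2 ^ j).
  elim: j => [|j IH]; first by rewrite mul0r sumr_ge0 // => i _; rewrite invr_ge0.
  have := @harmonic_sum_ge R (2 ^ j) (2 ^ j) (2 ^ j.+1).
  rewrite expnS mul2n -addnn => /(_ (leqnn _)).
  have -> : (2 ^ j)%:R / (2 ^ j + 2 ^ j)%:R = 1 / 2 :> R.
    rewrite natrD; field; rewrite -mulr2n mulrn_eq0 /= pnatr_eq0 expn_eq0 //.
  have -> : j.+1%:R = j%:R + 1 :> R by rewrite natr1.
  lra.
have [j Hj] := natr_ge_exists (x * 2); exists (2 ^ j)%N.
by apply: le_trans (pow j); rewrite ler_pdivlMr.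
Qed.

(* Take S maximising q(S)/|S| + (c/2) H_|S|: no vertex of S can be deleted profitably, so by
   the deletion bound all vertices have nearly equal weight. *)
Lemma spectral_regularization (R : realType) (c : R) (M : nat) : 0 < c -> c <= 1 ->
  exists N0 : nat, forall (n : nat) (G : rel 'I_n) (S0 : {set 'I_n}),
    symmetric G -> irreflexive G -> (N0 <= #|S0|)%N ->
    6 / 5 * #|S0|%:R <= q_index R (induced G S0) ->
    exists S : {set 'I_n}, [/\ S \subset S0, (M <= #|S|)%N,
      q_index R (induced G S0) / #|S0|%:R +
        c / 2 * (harmonic_sum R #|S0| - harmonic_sum R #|S|)
        <= q_index R (induced G S) / #|S|%:R &
      (q_index R (induced G S) / #|S|%:R / 2 - 12 * c) * #|S|%:R ^+ 2 <= (arcs G S)%:R].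
Proof.
move=> c0 c1.
have [L1 HL1] := natr_ge_exists (12 / c).
pose L := (M + L1).+1.
(* Descending to size [L] would cost at least 2 in the harmonic term, more than q(S)/|S| <= 2 can
   repay. *)
have [N1 HN1] := harmonic_sum_unbounded (harmonic_sum R L + 4 / c).
exists (L + N1)%N => n G S0 symG irrG leS0 qS0.
have S0L : (L <= #|S0|)%N by apply: leq_trans leS0; apply: leq_addr.
have hS0 : harmonic_sum R L + 4 / c <= harmonic_sum R #|S0|.
  by apply: (le_trans HN1); apply: harmonic_sum_mono; apply: leq_trans leS0; apply: leq_addl.
have n0 : (0 < n)%N.
  by rewrite -[n]card_ord (leq_trans _ (max_card (mem S0))) // (leq_trans _ S0L).
pose q (S : {set 'I_n}) := q_index R (induced G S).
pose Phi (S : {set 'I_n}) : R := q S / #|S|%:R + c / 2 * harmonic_sum R #|S|.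
have P0 : (S0 \subset S0) && (L <= #|S0|)%N by rewrite subxx.
case: (arg_maxP (P := [pred S : {set 'I_n} | (S \subset S0) && (L <= #|S|)%N]) Phi P0).
move=> S /= /andP[sS SL] max.
have N0 : 0 < #|S|%:R :> R by rewrite ltr0n (leq_trans _ SL).
have PhiS : q S0 / #|S0|%:R + c / 2 * harmonic_sum R #|S0| <= q S / #|S|%:R + c / 2 * harmonic_sum R #|S|.
  exact: max.
have hmono : harmonic_sum R #|S| <= harmonic_sum R #|S0|.
  by apply: harmonic_sum_mono; apply: subset_leq_card.
have r0 : 6 / 5 <= q S0 / #|S0|%:R by rewrite ler_pdivlMr // ltr0n (leq_trans _ S0L).
have rS : 6 / 5 <= q S / #|S|%:R.
  apply: (le_trans r0); have : c / 2 * harmonic_sum R #|S| <= c / 2 * harmonic_sum R #|S0|.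
    by rewrite ler_wpM2l // divr_ge0 // ltW.
  clear -PhiS; lra.
(* Strictness keeps S minus a vertex among the competitors. *)
have SL' : (L < #|S|)%N.
  rewrite ltn_neqAle SL andbT; apply/eqP => e.
  have : q S / #|S|%:R <= 2 by rewrite ler_pdivrMr //; apply: q_index_induced_le.
  have : c / 2 * (harmonic_sum R #|S| + 4 / c) <= c / 2 * harmonic_sum R #|S0|.
    by rewrite ler_wpM2l // -?e // divr_ge0 // ltW.
  have -> : c / 2 * (harmonic_sum R #|S| + 4 / c) = c / 2 * harmonic_sum R #|S| + 2.
    by field; rewrite gt_eqF.
  clear -PhiS r0; lra.
exists S; split => //.
- by apply: leq_trans SL; rewrite /L leqW // leq_addr.
- by rewrite -/(q S) -/(q S0); clear -PhiS; lra.
have qS : 6 / 5 * #|S|%:R <= q S by rewrite -ler_pdivlMr.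
have qpos : 0 < q S by apply: lt_le_trans qS; rewrite mulr_gt0 // divr_gt0.
have [w [w0 w1 hq hdel]] := spectral_weights symG irrG n0 qpos.
apply: (arcs_ge_of_weights symG _ w1 qS hq); first by rewrite (leq_trans _ SL).
move=> u uS; rewrite leNgt; apply/negP => lt.
have := hdel u uS; rewrite -/(q S) -/(q (S :\ u)).
have cS : #|S :\ u|.+1 = #|S| by rewrite (cardsD1 u S) uS.
have /max : (S :\ u \subset S0) && (L <= #|S :\ u|)%N.
  by rewrite (subset_trans (subsetDl _ _) sS) /= -ltnS cS.
have wu : (q S - #|nbrs G S u|%:R) * w u <= (1 - c) * q S / #|S|%:R.
  by apply: le_trans (ltW lt); rewrite lerDl; apply: sumr_ge0.
have dN : #|nbrs G S u|%:R <= #|S|%:R :> R.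
  by rewrite ler_nat -(card_nbrsD G S u) leq_addr.
have cN : 12 <= c * #|S|%:R.
  rewrite mulrC -ler_pdivrMr //; apply: (le_trans HL1); rewrite ler_nat.
  by apply: leq_trans SL; rewrite /L leqW // leq_addl.
rewrite /Phi -cS harmonic_sumS cS => hPhi.
have N1' : 0 < #|S :\ u|%:R :> R.
  by rewrite ltr0n -ltnS cS (leq_ltn_trans _ SL').
have NE : #|S|%:R = #|S :\ u|%:R + 1 :> R by rewrite natr1 cS.
move: (w u) (w0 u) wu lt => {hq w1 hdel} x x0 wu lt hdel.
move: lt hdel; set Ls := _ + \sum_(_ in _ | _) _ => lt hdel.
move: hPhi wu lt hdel qS qpos dN cN N0 N1' NE.
move: (q S) (q (S :\ u)) #|S :\ u|%:R #|S|%:R #|nbrs G S u|%:R Ls (harmonic_sum R _).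
clear -c0 c1 x0 => a b N' N d l h hPhi wu lt hdel qS qpos dN cN N0 N1' NE.
(* A vertex violating the bound has weight at most 6/N <= c/2, so deleting it would raise q/|S| by
   more than maximality ([hb]) permits. *)
have xN : x * N <= 6.
  have h1 : (a / 6) * x <= (a - d) * x by rewrite ler_wpM2r //; lra.
  have h2 : (1 - c) * a / N <= a / N.
    by rewrite ler_pdivrMr // divfK ?gt_eqF //; have := mulr_ge0 (ltW c0) (ltW qpos); lra.
  have : a / 6 * x <= a / N by lra.
  rewrite ler_pdivlMr // => h3.
  have : a * (x * N) <= a * 6 by lra.
  by rewrite ler_pM2l.
have xc : x <= c / 2.
  rewrite -(ler_pM2r N0); lra.
have hb : N * b <= N' * (a + c / 2).
  have : b / N' <= a / N + c / 2 * N^-1 by lra.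
  rewrite -mulrDl ler_pdivrMr // => h1.
  have : N * b <= N * ((a + c / 2) / N * N') by rewrite ler_pM2l.
  by have -> : N * ((a + c / 2) / N * N') = N' * (a + c / 2) by field; rewrite gt_eqF.
have lN : l * N < (1 - c) * a by rewrite -ltr_pdivlMr.
have h1 : (N * b) * (1 - x) <= N' * (a + c / 2) * (1 - x) by rewrite ler_wpM2r //; lra.
have h2 : N * (a * (1 - x) - l) <= N * (b * (1 - x)) by rewrite ler_pM2l.
have h3 : N' * c * (1 - x) <= a * c * (1 - x).
  by rewrite ler_wpM2r ?ler_wpM2r //; lra.
have h4 : a * (1 - x) * (1 - c / 2) < (1 - c) * a.
  have e : N * (a * (1 - x)) = N' * (a * (1 - x)) + a * (1 - x) by rewrite NE; ring.
  lra.
have h5 : a * (1 - c / 2) * (1 - c / 2) <= a * (1 - x) * (1 - c / 2).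
  by rewrite ler_wpM2r ?ler_wpM2l //; lra.
have h6 : 0 <= a * (c * c) by rewrite mulr_ge0 ?(ltW qpos) // mulr_ge0 // ltW.
lra.
Qed.

(** * Conclusion: few or many deleted vertices *)

Lemma arcsS (n : nat) (G : rel 'I_n) (S S' : {set 'I_n}) :
  S \subset S' -> (arcs G S <= arcs G S')%N.
Proof.
move=> sS; rewrite /arcs [leqRHS](big_setID S) /= (setIidPr sS).
apply: leq_trans (leq_addr _ _); apply: leq_sum => u _; apply: subset_leq_card.
by apply/subsetP => v; rewrite !inE => /andP[/(subsetP sS) -> ->].
Qed.

Theorem theorem2p13 (R : realType) (k : nat) (m : nat) (F : rel 'I_m) :
  (3 <= k)%N -> simple_graph F -> chromatic_number_is F k.+1 ->
  forall eps : R, 0 < eps ->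
  exists sigma : R, 0 < sigma /\
  exists n0 : nat, forall (n : nat) (G : rel 'I_n),
    (n0 <= n)%N -> simple_graph G -> F_free F G ->
    2 * (1 - 1 / k%:R - sigma) * n%:R <= q_index R G ->
    close_to G (turan n k) eps.
Proof.
move=> k3 _ [colF _] eps eps0.
have [m0|m0] := posnP m.
  exists 1; split=> //; exists 0%N => n G _ _ []; subst m.
  have phi : 'I_0 -> 'I_n by case.
  by exists phi; split; case.
have k0 : (0 < k)%N by apply: leq_trans k3.
have [th0 [kinv invp]] := one_minus_inv_bounds R k0.
(* Hence 2 (1 - 1/k) >= 4/3, with room above the 6/5 that regularization needs. *)
have inv3 : 1 / k%:R <= 1 / 3 :> R.
  by rewrite !mul1r lef_pV2 ?posrE ?ltr0n // ler_nat.
have [d' d'0 [N1 HN1]] := @close_to_turan_of_arcs R k m eps k0 m0 eps0.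
pose d := Num.min d' 1.
have d0 : 0 < d by rewrite lt_min d'0 ltr01.
have dd' : d <= d' by rewrite ge_min lexx.
have d1 : d <= 1 by rewrite ge_min lexx orbT.
clearbody d.
(* The guaranteed rise of q(S)/|S| at tolerance d/48 when at least (d/8) n vertices are deleted. *)
pose gap := d / 48 / 2 * (d / 8).
have gap0 : 0 < gap by rewrite mulr_gt0 // ?divr_gt0 // divr_gt0.
have gapd : gap <= d / 96.
  by rewrite -[leRHS]mulr1 /gap; apply: ler_pM; lra.
have [N2 HN2] := @erdos_stone R k (gap / 4) k0 (divr_gt0 gap0 (ltr0Sn R 3)) m.
(* The error 12 gap/192 = gap/16 leaves at least gap/4 of the density gain for Erdos-Stone. *)
have [||N3 HN3] := @spectral_regularization R (gap / 192) N2.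
- by lra.
- by lra.
have [||N4 HN4] := @spectral_regularization R (d / 48) N3.+1.
- by lra.
- by lra.
exists (gap / 16); split; first by rewrite divr_gt0.
exists (N1 + N4).+1 => n G len [symG irrG] freeG hq.
have nob : ~ has_blowup k.+1 m G [set: 'I_n] by move/(blowup_contains irrG colF).
have n1 : (0 < n)%N by apply: leq_trans len.
have nR : 0 < n%:R :> R by rewrite ltr0n.
have GT : induced G [set: 'I_n] = G.
  by apply/funext => u; apply/funext => v; rewrite /induced !finset.in_setT.
have hq' : 2 * (1 - 1 / k%:R - gap / 16) <= q_index R G / n%:R by rewrite ler_pdivlMr.
have [||S [_ SM hr hS]] := HN4 n G [set: 'I_n] symG irrG.
- by rewrite cardsT card_ord; apply: leq_trans len; rewrite leqW // leq_addl.
- rewrite GT cardsT card_ord; apply: le_trans hq; rewrite ler_pM2r //; lra.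
rewrite GT cardsT card_ord in hr.
have Sn : (#|S| <= n)%N by rewrite -[leqRHS](card_ord n) max_card.
set r := q_index R (induced G S) / _ in hr hS.
have S0 : 0 < #|S|%:R :> R by rewrite ltr0n (leq_trans _ SM).
have [big|small] := leP ((1 - d / 8) * n%:R) #|S|%:R.
  apply: HN1 => //; first by apply: leq_trans len; rewrite leqW // leq_addr.
  have h1 : 0 <= d / 48 / 2 * (harmonic_sum R n - harmonic_sum R #|S|).
    by rewrite mulr_ge0 ?subr_ge0 ?harmonic_sum_mono //; lra.
  have h2 : (arcs G S)%:R <= (arcs G [set: 'I_n])%:R :> R.
    by rewrite ler_nat arcsS // finset.subsetT.
  apply: le_trans h2; apply: le_trans hS.
  have h3 : ((1 - d / 8) * n%:R) ^+ 2 <= #|S|%:R ^+ 2.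
    by apply: lerXn2r => //; rewrite nnegrE ?ltW // mulr_gt0 //; lra.
  have h4 : (1 - d / 4) * n%:R ^+ 2 <= #|S|%:R ^+ 2.
    apply: le_trans h3; rewrite exprMn ler_wpM2r ?sqr_ge0 //.
    by have := sqr_ge0 d; rewrite expr2; lra.
  (* The density loses d/4 to regularization and gap/16 to sigma; shrinking to |S| costs another
     d/4, all within d. *)
  have rlow : 1 - 1 / k%:R - gap / 16 - d / 4 <= r / 2 - 12 * (d / 48) by clear -hr h1 hq'; lra.
  apply: (@le_trans _ _ ((1 - 1 / k%:R - gap / 16 - d / 4) * #|S|%:R ^+ 2)); last first.
    by rewrite ler_wpM2r // sqr_ge0.
  apply: (@le_trans _ _ ((1 - 1 / k%:R - gap / 16 - d / 4) * ((1 - d / 4) * n%:R ^+ 2))).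
    rewrite [leRHS]mulrA ler_wpM2r ?sqr_ge0 //.
    have : (1 / k%:R + gap / 16 + d / 4) * (d / 4) >= 0 by rewrite mulr_ge0 //; clear -invp gap0 d0; lra.
    clear -gapd d0 dd'; lra.
  by rewrite ler_wpM2l //; lra.
exfalso; apply: nob.
have hgain : gap <= d / 48 / 2 * (harmonic_sum R n - harmonic_sum R #|S|).
  rewrite /gap ler_pM2l; last by rewrite !divr_gt0.
  have := @harmonic_sum_ge R #|S| (n - #|S|) n; rewrite subnKC // => /(_ (leqnn _)).
  by apply: le_trans; rewrite ler_pdivlMr // natrB //; lra.
have rlow : 2 * (1 - 1 / k%:R) + 7 / 8 * gap <= r by lra.
have [||S' [sS' SM' hr' hS']] := HN3 n G S symG irrG.
- by apply: leq_trans SM; rewrite leqnSn.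
- by rewrite -ler_pdivlMr // -/r; lra.
apply: (has_blowupS (finset.subsetT S')); apply: (HN2 n G S') => //.
have h1 : 0 <= gap / 192 / 2 * (harmonic_sum R #|S| - harmonic_sum R #|S'|).
  by rewrite mulr_ge0 ?subr_ge0 ?harmonic_sum_mono ?subset_leq_card //; clear -gap0; lra.
apply: le_trans hS'; rewrite ler_wpM2r ?sqr_ge0 //.
by move: hr'; rewrite -/r; clear -rlow h1 gap0; lra.
Qed.
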